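(* Let $\Omega\subset\mathbb{R}^N$ be a bounded domain. Then the embedding $$\mathsf H(\Delta^2,\Omega)\cap\mathbb{BH}^\perp\hookrightarrow\mathsf L^2(\Omega)$$ is compact.
   Context: A domain is a (nonempty) connected open set $\Omega\subset\mathbb{R}^N$, $N\in\mathbb{N}$; no regularity of the boundary is assumed. $\mathsf H(\Delta^2,\Omega):=\{\varphi\in\mathsf L^2(\Omega):\Delta^2\varphi\in\mathsf L^2(\Omega)\}$ (distributional bi-Laplacian) with the graph norm $(\|\varphi\|_{\mathsf L^2}^2+\|\Delta^2\varphi\|_{\mathsf L^2}^2)^{1/2}$, $\mathbb{BH}:=\{\varphi\in\mathsf L^2(\Omega):\Delta^2\varphi=0\}$, and $\perp$ is orthogonality in $\mathsf L^2(\Omega)$. *)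

(* Defs.v *)
From HB Require Import structures.
From mathcomp Require Import all_boot all_order all_algebra.
From mathcomp Require Import all_classical all_reals all_analysis.
From mathcomp Require Import measurable_realfun.

Set Implicit Arguments.
Unset Strict Implicit.
Unset Printing Implicit Defensive.
Import Order.TTheory GRing.Theory Num.Theory.
Import numFieldNormedType.Exports.

Local Open Scope classical_set_scope.
Local Open Scope ring_scope.

Definition rV_display : measure_display. Proof. exact. Qed.

Section borel_rV.
Context (R : realType) (n : nat).

Definition rV_borel : set (set 'rV[R]_n) := <<s @open 'rV[R]_n >>.

Let rV_borel0 : rV_borel set0.
Proof. exact: sigma_algebra0. Qed.

Let rV_borelC A : rV_borel A -> rV_borel (~` A).
Proof. exact: sigma_algebraC. Qed.

Let rV_borel_bigcup (F : (set 'rV[R]_n)^nat) :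
  (forall i, rV_borel (F i)) -> rV_borel (\bigcup_i F i).
Proof. exact: sigma_algebra_bigcup. Qed.

HB.instance Definition _ := @isMeasurable.Build rV_display 'rV[R]_n rV_borel
  rV_borel0 rV_borelC rV_borel_bigcup.

Lemma open_measurable_rV (U : set 'rV[R]_n) : open U -> measurable U.
Proof. exact: sub_sigma_algebra. Qed.

Lemma continuous_measurable_rV (f : 'rV[R]_n -> R) :
  continuous f -> measurable_fun [set: 'rV[R]_n] f.
Proof.
move=> /continuousP cf; apply: (measurability _ (RGenOInfty.measurableE R)).
move=> _ [_ [a ->]] <-; rewrite setTI; apply: open_measurable_rV.
exact/cf/interval_open.
Qed.

End borel_rV.

Section lebesgue_rV.
Context (R : realType).

Definition cons_rV n (p : R * 'rV[R]_n) : 'rV[R]_n.+1 :=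
  \row_j (if unlift ord0 j is Some k then p.2 0 k else p.1).

Lemma cons_rV0 n (p : R * 'rV[R]_n) : cons_rV p 0 ord0 = p.1.
Proof. by rewrite mxE unlift_none. Qed.

Lemma cons_rVS n (p : R * 'rV[R]_n) k : cons_rV p 0 (lift ord0 k) = p.2 0 k.
Proof. by rewrite mxE liftK. Qed.

Lemma cons_rV_ballE n (p : R * 'rV[R]_n) q e : 0 < e ->
  ball (cons_rV q) e (cons_rV p) <-> ball q.1 e p.1 /\ ball q.2 e p.2.
Proof.
move=> e0; split=> [[_ H]|[H0 [_ HS]]].
  split; first by have := H 0 ord0; rewrite !cons_rV0.
  by split=> // i j; have := H 0 (lift ord0 j); rewrite !cons_rVS !ord1.
split=> // i j; rewrite ord1; case: (unliftP ord0 j) => [k|] ->.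
  by rewrite !cons_rVS; exact: HS.
by rewrite !cons_rV0.
Qed.

Lemma measurable_cons_rV n :
  measurable_fun [set: measurableTypeR R * 'rV[R]_n] (@cons_rV n).
Proof.
have rat_rV_near m (x : 'rV[R]_m) (e : R) : 0 < e ->
    exists q : 'rV[rat]_m, ball x e (map_mx ratr q).
  move=> e0.
  have H j : exists q : rat, ball (x 0 j) e (ratr q).
    have [||y [xq [q _ qy]]] := @dense_rat R (ball (x 0 j) e).
    - by exists (x 0 j); exact: ballxx.
    - exact: ball_open.
    - by exists q; rewrite qy.
  exists (\row_j xget 0 [set q | ball (x 0 j) e (ratr q)]).
  by split=> // i j; rewrite !mxE ord1; exact: xgetPex (H j).
apply: (@measurability _ _ _ _ _ _ (@open 'rV[R]_n.+1)) => //.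
move=> _ [U oU <-]; rewrite setTI.
pose I := ('rV[rat]_n.+1 * nat)%type.
pose B (i : I) : set (R * 'rV[R]_n) :=
  if `[< ball (map_mx ratr i.1 : 'rV[R]_n.+1) i.2.+1%:R^-1 `<=` U >] then
    cons_rV (n := n) @^-1` ball (map_mx ratr i.1 : 'rV[R]_n.+1) i.2.+1%:R^-1
  else set0.
have -> : cons_rV (n := n) @^-1` U = \bigcup_i B i.
  apply/seteqP; split=> [p Up|p [i _]]; last first.
    by rewrite /B; case: asboolP => // iU /iU.
  have /nbhs_ballP[e /= e0 eU] := open_nbhs_nbhs (conj oU Up).
  have [k ke] : exists k : nat, k.+1%:R^-1 < e / 2.
    have /ltr_add_invr[k] : 0 < e / 2 by rewrite divr_gt0.
    by rewrite add0r => ?; exists k.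
  have k0 : 0 < k.+1%:R^-1 :> R by rewrite invr_gt0.
  have [q qp] := rat_rV_near _ (cons_rV p) _ k0.
  exists (q, k) => //; rewrite /B asboolT => /=; first exact/ball_sym.
  move=> z qz; apply: eU; rewrite [e]splitr.
  by apply: ball_triangle (le_ball (ltW ke) qp) (le_ball (ltW ke) qz).
apply: countable_bigcupT_measurable; first exact: countableP.
move=> [q k]; rewrite /B; case: asboolP => // _ /=.
have k0 : 0 < k.+1%:R^-1 :> R by rewrite invr_gt0.
have -> : map_mx ratr q =
    cons_rV (ratr (q 0 ord0), (\row_j ratr (q 0 (lift ord0 j))) : 'rV[R]_n).
  apply/rowP => j; rewrite mxE; case: (unliftP ord0 j) => [l|] ->.
    by rewrite cons_rVS mxE.
  by rewrite cons_rV0.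
set c := (ratr _, _).
have -> : cons_rV (n := n) @^-1` ball (cons_rV c) k.+1%:R^-1 =
    ball c.1 k.+1%:R^-1 `*` ball c.2 k.+1%:R^-1.
  by apply/seteqP; split => p /(cons_rV_ballE _ _ k0).
apply: measurableX; first exact: measurable_ball.
apply: open_measurable_rV; exact: ball_open.
Qed.

Definition uncons_rV n (x : 'rV[R]_n.+1) : measurableTypeR R * 'rV[R]_n :=
  (x 0 ord0, \row_k x 0 (lift ord0 k)).

Lemma cons_rVK n : cancel (@cons_rV n) (@uncons_rV n).
Proof.
move=> [x v]; congr (_, _); first by rewrite cons_rV0.
by apply/rowP => k; rewrite mxE cons_rVS.
Qed.

Lemma measurable_uncons_rV n : measurable_fun setT (@uncons_rV n).
Proof.
apply: measurable_fun_pair.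
  by apply: continuous_measurable_rV; exact: coord_continuous.
apply: (@measurability _ _ _ _ _ _ (@open 'rV[R]_n)) => //.
move=> _ [U oU <-]; rewrite setTI; apply: open_measurable_rV.
rewrite openE => x /= Ux.
have /nbhs_ballP[e /= e0 eU] := open_nbhs_nbhs (conj oU Ux).
apply/nbhs_ballP; exists e => //= y [_ xy]; apply: eU.
by split=> // i j; rewrite !mxE; exact: xy.
Qed.

Section step.
Context (n : nat) (m : {sigma_finite_measure set 'rV[R]_n -> \bar R}).
Local Open Scope ereal_scope.

Definition lebesgue_rV_step : set 'rV[R]_n.+1 -> \bar R :=
  pushforward (@lebesgue_measure R \x m) (@cons_rV n).

Let mcons A : measurable A -> measurable (@cons_rV n @^-1` A).
Proof. by move=> mA; rewrite -[X in measurable X]setTI; exact: measurable_cons_rV. Qed.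

Let step0 : lebesgue_rV_step set0 = 0.
Proof. by rewrite /lebesgue_rV_step /pushforward preimage_set0 measure0. Qed.

Let step_ge0 A : 0 <= lebesgue_rV_step A.
Proof. by rewrite /lebesgue_rV_step /pushforward; exact: measure_ge0. Qed.

Let step_sigma_additive : semi_sigma_additive lebesgue_rV_step.
Proof.
move=> F mF tF mUF; rewrite /lebesgue_rV_step /pushforward preimage_bigcup.
apply: measure_semi_sigma_additive => [k||]; first exact: mcons.
- apply/trivIsetP => /= i j _ _ ij; rewrite -preimage_setI.
  by move/trivIsetP : tF => /(_ _ _ _ _ ij) ->//; rewrite preimage_set0.
- by rewrite -preimage_bigcup; exact: mcons.
Qed.

HB.instance Definition _ := isMeasure.Build _ _ _
  lebesgue_rV_step step0 step_ge0 step_sigma_additive.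

Let step_sigma_finite : sigma_finite setT lebesgue_rV_step.
Proof.
have /sigma_finiteP[F [TF ndF Foo]] := sigma_finiteT (@lebesgue_measure R).
have /sigma_finiteP[G [TG ndG Goo]] := sigma_finiteT m.
exists (fun k => @uncons_rV n @^-1` (F k `*` G k)).
  rewrite -preimage_bigcup (_ : \bigcup_k _ = setT) ?preimage_setT//.
  rewrite -subTset => -[x y] _.
  have [i _ Fx] : (\bigcup_k F k) x by rewrite -TF.
  have [j _ Gy] : (\bigcup_k G k) y by rewrite -TG.
  exists (maxn i j) => //; split => /=.
  - by move: x Fx; exact/subsetPset/ndF/leq_maxl.
  - by move: y Gy; exact/subsetPset/ndG/leq_maxr.
move=> k; have [mF Fk] := Foo k; have [mG Gk] := Goo k; split.
  rewrite -[X in measurable X]setTI; apply: measurable_uncons_rV => //.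
  exact: measurableX.
rewrite /lebesgue_rV_step /pushforward -comp_preimage.
rewrite (_ : _ \o _ = id); last by apply/funext => x /=; rewrite cons_rVK.
by rewrite preimage_id product_measure1E// lte_mul_pinfty// ge0_fin_numE.
Qed.

HB.instance Definition _ := Measure_isSigmaFinite.Build _ _ _
  lebesgue_rV_step step_sigma_finite.

End step.

Definition lebesgue_rV0 : set 'rV[R]_0 -> \bar R := dirac (0 : 'rV[R]_0).

HB.instance Definition _ := Measure.on lebesgue_rV0.

Let lebesgue_rV0_sigma_finite : sigma_finite setT lebesgue_rV0.
Proof. by apply: fin_num_fun_sigma_finite; rewrite ?measure0. Qed.

HB.instance Definition _ := Measure_isSigmaFinite.Build _ _ _
  lebesgue_rV0 lebesgue_rV0_sigma_finite.

Fixpoint lebesgue_rV n : {sigma_finite_measure set 'rV[R]_n -> \bar R} :=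
  if n is n'.+1 then lebesgue_rV_step (lebesgue_rV n') else lebesgue_rV0.

Lemma lebesgue_rV_box n (a b : 'rV[R]_n) : (forall i, a 0 i <= b 0 i) ->
  lebesgue_rV n [set x : 'rV[R]_n | forall i, a 0 i <= x 0 i <= b 0 i] =
  (\prod_i (b 0 i - a 0 i))%:E.
Proof.
elim: n a b => [|n IH] a b ab.
  rewrite big_ord0 /= /lebesgue_rV0 /dirac indicE mem_set// => i; by case: i.
pose a' : 'rV[R]_n := (uncons_rV a).2; pose b' : 'rV[R]_n := (uncons_rV b).2.
have ab' i : a' 0 i <= b' 0 i by rewrite !mxE.
rewrite /= /lebesgue_rV_step /pushforward.
have -> : cons_rV (n := n) @^-1` [set x | forall i, a 0 i <= x 0 i <= b 0 i] =
    `[a 0 ord0, b 0 ord0]%classic `*`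
    [set x : 'rV[R]_n | forall i, a' 0 i <= x 0 i <= b' 0 i].
  apply/seteqP; split => -[x v] /=.
    move=> H; split; first by have := H ord0; rewrite cons_rV0 in_itv.
    by move=> i; have := H (lift ord0 i); rewrite cons_rVS !mxE.
  move=> [+ H] i; rewrite in_itv /= => H0.
  case: (unliftP ord0 i) => [k|] ->; last by rewrite cons_rV0.
  by rewrite cons_rVS; have := H k; rewrite !mxE.
rewrite product_measure1E; first last.
- have -> : [set x : 'rV[R]_n | forall i, a' 0 i <= x 0 i <= b' 0 i] =
      \bigcap_(i in [set: 'I_n]) (fun x => x 0 i) @^-1` `[a' 0 i, b' 0 i].
    apply/seteqP; split => x H i; first by move=> _ /=; rewrite in_itv; exact: H.
    by have := H i I; rewrite /= in_itv.
  apply: fin_bigcap_measurable => // i _.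
  rewrite -[X in measurable X]setTI; apply: continuous_measurable_rV => //.
  exact: coord_continuous.
- exact: measurable_itv.
rewrite IH// big_ord_recl EFinM; congr (_ * _)%E.
  rewrite [LHS](lebesgue_measure_itv `[a 0 ord0, b 0 ord0]) /= lte_fin.
  case: ltP => [_|ba]; first by rewrite EFinB.
  have ->// : b 0 ord0 = a 0 ord0 by apply/le_anti; rewrite ba ab.
  by rewrite subrr.
by congr EFin; apply: eq_bigr => i _; rewrite !mxE.
Qed.

End lebesgue_rV.

Section L2.
Context (R : realType) (n : nat) (Omega : set 'rV[R]_n) (oOmega : open Omega).

Definition lebesgue_on : {measure set 'rV[R]_n -> \bar R} :=
  mrestr (lebesgue_rV R n) (open_measurable_rV oOmega).

(* Elements are functions, not classes modulo equality almost everywhere: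
   [L2norm] below is only a seminorm. Since the measure ignores ~` Omega, so
   does everything below. *)
Definition L2 := LfunType lebesgue_on (lee1n 2).

Definition L2norm (f : L2) : R := fine ('N[lebesgue_on]_2%:E [EFin \o f])%E.

Definition L2inner (f g : L2) : R := \int[lebesgue_on]_x (f x * g x).

Definition L2orth (A : set L2) : set L2 :=
  [set f | forall g, A g -> L2inner f g = 0].

End L2.

Section test_functions.
Context (R : realType) (n : nat).
Implicit Types (f : 'rV[R]_n -> R).

Definition partial (i : 'I_n) f : 'rV[R]_n -> R := 'D_(delta_mx 0 i) f.

Definition iter_partial (s : seq 'I_n) f : 'rV[R]_n -> R := foldr partial f s.

Definition smooth f := forall s : seq 'I_n,
  continuous (iter_partial s f) /\
  forall i x, derivable (iter_partial s f) x (delta_mx 0 i).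

Definition laplacian f : 'rV[R]_n -> R :=
  fun x => \sum_(i < n) partial i (partial i f) x.

Definition bilaplacian f := laplacian (laplacian f).

Definition supp f : set 'rV[R]_n := closure [set x | f x != 0].

Definition test_function (Omega : set 'rV[R]_n) f :=
  [/\ smooth f, compact (supp f) & supp f `<=` Omega].

End test_functions.

Section bilaplacian_spaces.
Context (R : realType) (n : nat) (Omega : set 'rV[R]_n) (oOmega : open Omega).
Local Notation L2 := (L2 oOmega).
Local Notation mu := (lebesgue_on oOmega).

Definition is_weak_bilaplacian (f g : L2) := forall phi,
  test_function Omega phi ->
  \int[mu]_x (f x * bilaplacian phi x) = \int[mu]_x (g x * phi x).

Definition Hbilap : set L2 := [set f | exists g, is_weak_bilaplacian f g].

(* A representative of the distributional bi-Laplacian of f in [Hbilap],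
   which is determined almost everywhere on Omega. *)
Definition weak_bilaplacian (f : L2) : L2 :=
  xget 0 [set g | is_weak_bilaplacian f g].

Definition Hbilap_norm (f : L2) : R :=
  Num.sqrt (L2norm f ^+ 2 + L2norm (weak_bilaplacian f) ^+ 2).

Definition BH : set L2 := [set f | is_weak_bilaplacian f 0].

(* The inclusion in L^2(Omega) of the linear subspace X, normed by normX, is
   a compact operator: it is bounded, and every normX-bounded sequence of X
   has a subsequence that converges in L^2(Omega). *)
Definition compact_embedding_L2 (X : set L2) (normX : L2 -> R) :=
  (exists C : R, forall f, X f -> L2norm f <= C * normX f) /\
  forall u : nat -> L2,
    (forall k, X (u k)) -> (exists M : R, forall k, normX (u k) <= M) ->
    exists2 s : nat -> nat, {homo s : i j / (i < j)%N} &
      exists f : L2, L2norm (u (s k) - f) @[k --> \oo] --> (0 : R).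

End bilaplacian_spaces.

Arguments L2orth {R n Omega oOmega} A _.
Arguments Hbilap {R n Omega} oOmega _.
Arguments BH {R n Omega} oOmega _.
Arguments Hbilap_norm {R n Omega} oOmega f.

(* Main.v *)
Require Import Defs.
From mathcomp Require Import all_boot all_order all_algebra.
From mathcomp Require Import all_classical all_reals all_analysis.
From mathcomp Require Import measurable_realfun ring lra.

(* Since BH is by definition the orthogonal of the range of the bi-Laplacian on
   test functions, BH^perp is the closure of that range. Given f_k bounded in
   the graph norm and orthogonal to BH, choose test functions phi_k such that
   f_k - bilap phi_k tends to 0. Integration by parts and Poincare's inequality
   bound phi_k and its gradient by bilap phi_k, so phi_k is precompact in L^2 by
   Friedrichs' inequality
     |phi|^2 <= sum_j (int phi w_j)^2 + e sum_i |d_i phi|^2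
   (finitely many bounded weights w_j, depending on e). Precompactness passes
   to f_k, whatever the boundary of Omega, because
     |f_k - f_l|^2 ~ <f_k - f_l, bilap (phi_k - phi_l)>
                   = <bilap f_k - bilap f_l, phi_k - phi_l>.
   Subsequences are extracted at the end only: precompactness is expressed by
   the Cauchy property along a free ultrafilter on nat. *)

Set Implicit Arguments.
Unset Strict Implicit.
Unset Printing Implicit Defensive.
Import Order.TTheory GRing.Theory Num.Theory.
Import numFieldNormedType.Exports.

Local Open Scope classical_set_scope.
Local Open Scope ring_scope.

(** * The space L^2 *)

(** The obstacle is that elements of [Hbilap] are not controlled near the boundary of [Omega], so no
    Sobolev estimate applies to f_k itself. All derivative estimates are made on phi_k, which does
    not approximate f_k but acts as an approximate solution of bilap phi = f_k with vanishing
    boundary data. Extended by zero, phi_k lives on a fixed box containing [Omega], where everything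
    reduces to Fubini and one-dimensional calculus. The last identity of the overview is then just
    the definition of the weak bi-Laplacian, tested against each phi_l. The weights in Friedrichs'
    inequality depend on e, so ordinary sequences would require a diagonal extraction. Along an
    ultrafilter every bounded real sequence is Cauchy at once, and finitely many weights cost one
    finite intersection. Completeness of L^2 serves twice, for the projection behind the density
    statement and for the final limit. In both cases consecutive distances of at most 4^-k are
    available, which leaves room for a weight 4^k in the pointwise convergence argument. *)

Lemma exists_expr4V_lt (R : realType) (e : R) : 0 < e -> exists k, 4^-1 ^+ k < e.
Proof.
move=> e0; have [k] : exists k : nat, k.+1%:R^-1 < e.
  by have /ltr_add_invr[k] := e0; rewrite add0r => ?; exists k.
move=> ke; exists k; apply: le_lt_trans ke.
rewrite exprVn lef_pV2 ?posrE ?exprn_gt0// -natrX ler_nat.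
exact: ltn_expl.
Qed.

Lemma ler_add_expr4V (R : realType) (a b C : R) :
  (forall k, a <= b + C * 4^-1 ^+ k) -> a <= b.
Proof.
move=> H; apply/ler_addgt0Pl => e e0.
have C0 : 0 < `|C| + 1 by rewrite ltr_wpDl.
have [k ke] := exists_expr4V_lt (divr_gt0 e0 C0).
apply: le_trans (H k) _; rewrite addrC lerD2r.
move: ke; rewrite ltr_pdivlMr// => /ltW; apply: le_trans.
rewrite mulrC ler_wpM2l// ?exprn_ge0//.
by apply: le_trans (ler_norm C) _; rewrite lerDl.
Qed.

Lemma ler_add_sqr (R : realFieldType) (x y c a : R) : 0 <= x -> 0 <= y -> 0 <= c ->
  a <= y ^+ 2 -> x ^+ 2 < a + c ^+ 2 -> x <= y + c.
Proof.
move=> x0 y0 c0 ay xa; rewrite -(ler_pXn2r (ltn0Sn 1)) ?nnegrE ?addr_ge0//.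
have := mulr_ge0 y0 c0; nra.
Qed.

(** Sets [A k] of [U] on which [D] is below 4^-k meet pairwise and meet every tail, because [U]
    contains [\oo]. This allows a recursive choice of increasing indices. *)
Lemma ultra_fast_subseq (R : realType) (U : set_system nat) (D : nat -> nat -> R) :
  UltraFilter U -> \oo `<=` U ->
  (forall e, 0 < e -> exists2 A, U A & forall k l, A k -> A l -> D k l < e) ->
  exists2 s : nat -> nat, {homo s : i j / (i < j)%N} &
    forall k, D (s k.+1) (s k) <= 4^-1 ^+ k.
Proof.
move=> UU ooU HD.
have e0 k : 0 < (4^-1 : R) ^+ k by rewrite exprn_gt0.
pose A k := xget setT [set A | U A /\ forall i j, A i -> A j -> D i j < 4^-1 ^+ k].
have AP k : U (A k) /\ forall i j, A k i -> A k j -> D i j < 4^-1 ^+ k.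
  have [B UB BD] := HD _ (e0 k).
  pose good := [set A | U A /\ forall i j, A i -> A j -> D i j < 4^-1 ^+ k].
  by apply: (@xgetPex _ setT good); exists B.
(* Asking also for membership in [A k.-1] puts both [s k] and [s k.+1] in [A k]; for [k = 0] the
   condition is merely repeated, since [0.-1 = 0]. *)
pose P (k m : nat) := [set j | [/\ A k j, A k.-1 j & (m < j)%N]].
have PP k m : exists j, P k m j.
  have /filter_ex[j [[Aj Aj'] mj]] : U ((A k `&` A k.-1) `&` [set j | (m < j)%N]).
    apply: filterI; first by apply: filterI; [have [] := AP k | have [] := AP k.-1].
    by apply: ooU; exists m.+1.
  by exists j; split.
pose nx k m := xget 0%N (P k m).
have nxP k m : P k m (nx k m) by apply: xgetPex; exact: PP.
pose s := fix s k := if k is k'.+1 then nx k (s k') else nx 0%N 0%N.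
have sA k : A k (s k) by case: k => [|k] /=; [have [] := nxP 0 0|have [] := nxP k.+1 (s k)].
have sA' k : A k (s k.+1) by have [] := nxP k.+1 (s k).
have slt k : (s k < s k.+1)%N by have [] := nxP k.+1 (s k).
exists s; first by apply: homo_ltn => //; exact: ltn_trans.
by move=> k; apply: ltW; have [_] := AP k; apply.
Qed.

Section L2_space.
Context d (T : measurableType d) (R : realType).
Variable mu : {measure set T -> \bar R}.
Local Notation L2 := (LfunType mu (lee1n 2)).
Local Notation ip f g := (\int[mu]_x ((f : L2) x * (g : L2) x)).
Local Notation nm f := (fine ('N[mu]_2%:E [EFin \o (f%R : L2)])%E).
Implicit Types f g h : L2.

Lemma L2_measurable f : measurable_fun setT f.
Proof. exact: measurable_funP. Qed.

Lemma L2_mul_integrable f g :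
  mu.-integrable setT (EFin \o (fun x => f x * g x)).
Proof. by apply/Lfun1_integrable; apply: Lfun2_mul_Lfun1; exact: LfunP. Qed.

Lemma integral_poweR_sqr (f : T -> R) :
  (\int[mu]_x (`|(EFin \o f) x| `^ 2))%E = (\int[mu]_x (f x ^+ 2)%:E)%E.
Proof.
apply: eq_integral => x _; rewrite [`|_|%E]abse_EFin poweR_EFin powR_mulrn//.
by rewrite real_normK ?num_real.
Qed.

Lemma L2_sqr_lty (f : T -> R) : measurable_fun setT f ->
  (\int[mu]_x (f x ^+ 2)%:E < +oo)%E -> f \in Lfun mu 2%:E.
Proof.
move=> mf foo; rewrite inE; apply/andP; split; rewrite inE//=.
by rewrite /finite_norm unlock /Lnorm; apply: poweR_lty; rewrite integral_poweR_sqr.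
Qed.

Lemma L2norm_ge0 f : 0 <= nm f.
Proof. by rewrite fine_ge0// Lnorm_ge0. Qed.

Lemma L2norm_sqrE f : ((nm f ^+ 2)%:E = \int[mu]_x (f x ^+ 2)%:E)%E.
Proof.
rewrite -integral_poweR_sqr -powR_Lnorm// -(finite_norm_fine f) poweR_EFin.
by rewrite powR_mulrn// L2norm_ge0.
Qed.

Lemma L2norm_sqr f : nm f ^+ 2 = ip f f.
Proof.
have /(congr1 fine) /= -> := L2norm_sqrE f.
by under eq_Rintegral do rewrite -expr2.
Qed.

Lemma L2norm_triangle f g : nm (f + g) <= nm f + nm g.
Proof. exact: ler_LnormD. Qed.

Lemma L2norm_opp f : nm (- f) = nm f.
Proof. exact: LnormrN. Qed.

Lemma L2norm_scale a f : nm (a *: f) = `|a| * nm f.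
Proof.
apply/EFin_inj; rewrite finite_norm_fine EFinM finite_norm_fine.
exact: LnormZ.
Qed.

Lemma ipC f g : ip f g = ip g f.
Proof. by apply: eq_Rintegral => x _; rewrite mulrC. Qed.

Lemma ipDl f g h : ip (f + g) h = ip f h + ip g h.
Proof.
rewrite -RintegralD//; [|exact: L2_mul_integrable..].
by apply: eq_Rintegral => x _; rewrite mulrDl.
Qed.

Lemma ipZl a f h : ip (a *: f) h = a * ip f h.
Proof.
rewrite -RintegralZl//; last exact: L2_mul_integrable.
by apply: eq_Rintegral => x _; rewrite mulrA.
Qed.

Lemma ipNl f h : ip (- f) h = - ip f h.
Proof. by rewrite -scaleN1r ipZl mulN1r. Qed.

Lemma ipBl f g h : ip (f - g) h = ip f h - ip g h.
Proof. by rewrite ipDl ipNl. Qed.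

Lemma ipDr f g h : ip h (f + g) = ip h f + ip h g.
Proof. by rewrite ipC ipDl !(ipC h). Qed.

Lemma ipZr a f h : ip h (a *: f) = a * ip h f.
Proof. by rewrite ipC ipZl (ipC h). Qed.

Lemma ipBr f g h : ip h (f - g) = ip h f - ip h g.
Proof. by rewrite ipC ipBl !(ipC h). Qed.

Lemma L2norm_sqrB f g : nm (f - g) ^+ 2 = nm f ^+ 2 - 2 * ip f g + nm g ^+ 2.
Proof.
rewrite !L2norm_sqr ipBl !ipBr (ipC g f); ring.
Qed.

Lemma L2_cauchy_schwarz f g : `|ip f g| <= nm f * nm g.
Proof.
rewrite -lee_fin EFinM !finite_norm_fine EFin_normr_Rintegral//; last first.
  exact: L2_mul_integrable.
have h2 : (2^-1 + 2^-1 = 1 :> R)%R by rewrite [RHS]splitr !div1r.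
apply: le_trans (hoelder mu (L2_measurable f) (L2_measurable g) _ _ h2) => //.
rewrite Lnorm1; apply: le_abse_integral => //.
by have /integrableP[] := L2_mul_integrable f g.
Qed.

Lemma L2norm_distC f g : nm (f - g) = nm (g - f).
Proof. by rewrite -L2norm_opp opprB. Qed.

Lemma L2norm_dist_triangle h f g : nm (f - g) <= nm (f - h) + nm (h - g).
Proof. by apply: le_trans (L2norm_triangle _ _); rewrite addrA subrK. Qed.

(** In the application [b], [b'] are the bi-Laplacians of test functions [p], [p'], and [g], [g']
    are the weak bi-Laplacians of [f], [f']. In f - f' = (b - b') + (f - b) - (f' - b'), the four
    pairings turn <f - f', b - b'> into <g - g', p - p'>, and Cauchy-Schwarz bounds each term. *)
Lemma L2norm_sqrB_le_pairing f f' b b' g g' p p' :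
  ip f b = ip g p -> ip f b' = ip g p' -> ip f' b = ip g' p -> ip f' b' = ip g' p' ->
  nm (f - f') ^+ 2 <= nm (g - g') * nm (p - p') + nm (f - f') * (nm (f - b) + nm (f' - b')).
Proof.
move=> e1 e2 e3 e4.
have -> : nm (f - f') ^+ 2 = ip (g - g') (p - p') +
    (ip (f - f') (f - b) - ip (f - f') (f' - b')).
  by rewrite L2norm_sqr !(ipBl, ipBr) e1 e2 e3 e4; ring.
have h1 := ler_norm (ip (g - g') (p - p')).
have h2 := ler_norm (ip (f - f') (f - b)).
rewrite mulrDr; apply: lerD; first exact: le_trans h1 (L2_cauchy_schwarz _ _).
apply: lerD; first exact: le_trans h2 (L2_cauchy_schwarz _ _).
by apply: le_trans (L2_cauchy_schwarz _ _); rewrite -normrN ler_norm.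
Qed.

Lemma L2norm_telescope (u : nat -> L2) (m k : nat) :
  (forall j, nm (u j.+1 - u j) <= 4^-1 ^+ j) ->
  nm (u m - u (m + k)%N) <= 2 * 4^-1 ^+ m.
Proof.
move=> ul.
(* The strengthened bound is inductive: step j = m + k costs 4^-j, while 2 * 4^-j drops by 3/2 *
   4^-j. *)
suff : nm (u m - u (m + k)%N) <= 2 * 4^-1 ^+ m - 2 * 4^-1 ^+ (m + k).
  by move=> /le_trans; apply; rewrite gerBl mulr_ge0// exprn_ge0.
elim: k => [|k IH].
  by rewrite addn0 !subrr -(scale0r (0 : L2)) L2norm_scale normr0 mul0r.
apply: le_trans (L2norm_dist_triangle (u (m + k)%N) _ _) _.
rewrite addnS exprS (L2norm_distC (u (m + k)%N)).
have := ul (m + k)%N.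
have : 0 <= 4^-1 ^+ (m + k) :> R by rewrite exprn_ge0.
move: IH; set a := nm _; set b := nm _; set c := _ ^+ (m + k); set e := 2 * _ ^+ m.
lra.
Qed.

(** Riesz-Fischer for fast Cauchy sequences: the limit is found pointwise almost everywhere, then
    Fatou's lemma carries the bounds on u_m - u_(m+k) over to u_m - f. *)
Lemma L2_complete (u : nat -> L2) :
  (forall k, nm (u k.+1 - u k) <= 4^-1 ^+ k) ->
  exists f : L2, forall m, nm (u m - f) <= 2 * 4^-1 ^+ m.
Proof.
move=> ul.
(* The weight 4^k still leaves [D k] an integral of at most 4^-k, so the sum [S] is finite almost
   everywhere; there the increments of [u] are at most sqrt(S) * 2^-k, hence summable. *)
pose D k x := ((4 ^+ k * (u k.+1 x - u k x) ^+ 2)%:E).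
have mu_ k : measurable_fun setT (u k) by exact: L2_measurable.
have mD k : measurable_fun setT (D k).
  apply/measurable_EFinP; apply: measurable_funM => //.
  by apply: measurable_funX; exact: measurable_funB.
have D0 k x : (0 <= D k x)%E by rewrite lee_fin mulr_ge0 ?sqr_ge0 ?exprn_ge0.
have iD k : (\int[mu]_x D k x <= (4^-1 ^+ k)%:E)%E.
  rewrite /D; under eq_integral do rewrite EFinM.
  rewrite ge0_integralZl//; last first.
  - by move=> x _; rewrite lee_fin sqr_ge0.
  - by apply/measurable_EFinP; apply: measurable_funX; exact: measurable_funB.
  - rewrite -[X in (_ * X)%E](L2norm_sqrE (u k.+1 - u k)) -EFinM lee_fin.
    apply: (@le_trans _ _ (4 ^+ k * (4^-1 ^+ k) ^+ 2)).
      by rewrite ler_wpM2l ?exprn_ge0// lerXn2r ?nnegrE ?exprn_ge0 ?L2norm_ge0.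
    by rewrite expr2 mulrA -exprMn divff// expr1n mul1r.
pose S x := (\sum_(0 <= k <oo) D k x)%E.
have S0 x : (0 <= S x)%E by apply: nneseries_ge0.
have mS : measurable_fun setT S by apply: ge0_emeasurable_sum => // k x _ _; exact: D0.
have iS : mu.-integrable setT S.
  apply/integrableP; split=> //.
  under eq_integral do rewrite gee0_abs//.
  rewrite integral_nneseries//.
  apply: (@le_lt_trans _ _ (\sum_(0 <= k <oo) (4^-1 ^+ k)%:E)%E).
    apply: lee_nneseries => // k *; apply: integral_ge0 => *; exact: D0.
  have cg : cvgn (series (geometric 1 (4^-1 : R))).
    by apply: is_cvg_geometric_series; rewrite ger0_norm//; lra.
  have -> : (\sum_(0 <= k <oo) (4^-1 ^+ k)%:E)%E =
      (limn (series (geometric 1 (4^-1 : R))))%:E.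
    rewrite -EFin_lim//; apply: congr_lim; apply/funext => k /=.
    by rewrite /series /= -sumEFin; apply: eq_bigr => i _; rewrite mul1r.
  exact: ltry.
have aecv : {ae mu, forall x, cvgn (u ^~ x)}.
  have := integrable_ae measurableT iS; apply: filterS => x /(_ I) Sx.
  have Dx k : `|u k.+1 x - u k x| <= Num.sqrt (fine (S x)) * 2^-1 ^+ k.
    have : (D k x <= S x)%E.
      rewrite /S; apply: le_trans (nneseries_lim_ge k.+1 _) => //.
      by rewrite big_nat_recr//= leeDr// sume_ge0.
    move=> DS; have H : 4 ^+ k * (u k.+1 x - u k x) ^+ 2 <= fine (S x).
      by rewrite -lee_fin fineK.
    have -> : 2^-1 ^+ k = Num.sqrt ((4^-1 : R) ^+ k).
      rewrite (_ : 4^-1 = 2^-1 ^+ 2 :> R); last by rewrite exprVn; congr _^-1; ring.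
      by rewrite exprAC sqrtr_sqr ger0_norm ?exprn_ge0.
    rewrite -sqrtr_sqr -sqrtrM ?fine_ge0//; apply: ler_wsqrtr; rewrite exprVn.
    by rewrite ler_pdivlMr ?exprn_gt0// mulrC.
  have cs : cvgn (series (fun k => u k.+1 x - u k x)).
    apply: normed_cvg; apply: (@series_le_cvg _ _
      (geometric (Num.sqrt (fine (S x))) 2^-1)) => [k|k|k|].
    - exact: normr_ge0.
    - by rewrite /geometric/= mulr_ge0 ?sqrtr_ge0 ?exprn_ge0.
    - exact: Dx.
    - by apply: is_cvg_geometric_series; rewrite ger0_norm//; lra.
  have -> : (fun k => u k x) = (fun k => u 0%N x + series (fun k => u k.+1 x - u k x) k).
    by apply/funext => k; rewrite /series /= telescope_sumr// addrC subrK.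
  by apply: is_cvgD => //; exact: is_cvg_cst.
(* An upper limit is measurable without any convergence assumption, and equals the limit wherever
   the latter exists. *)
pose f x := fine (limn_esup (fun k => (u k x)%:E)).
have mf : measurable_fun setT f.
  apply: measurableT_comp; first exact: measurable_realfun.fine_measurable.
  apply: measurable_realfun.measurable_fun_limn_esup => k.
  exact/measurable_EFinP.
have fE x : cvgn (u ^~ x) -> u ^~ x @ \oo --> f x.
  move=> cx; suff /cvg_limn_einf_sup[_ ufE] :
    (u k x)%:E @[k --> \oo] --> (limn (u ^~ x))%:E by rewrite /f ufE.
  by apply: cvg_EFin; [exact: nearW|exact: cx].
have le m : (\int[mu]_x ((u m x - f x) ^+ 2)%:E <= ((2 * 4^-1 ^+ m) ^+ 2)%:E)%E.
  pose F k x := ((u m x - u (m + k)%N x) ^+ 2)%:E.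
  have mF k : measurable_fun setT (F k).
    by apply/measurable_EFinP; apply: measurable_funX; exact: measurable_funB.
  have F0 k x : (0 <= F k x)%E by rewrite lee_fin sqr_ge0.
  have iF k : (\int[mu]_x F k x <= ((2 * 4^-1 ^+ m) ^+ 2)%:E)%E.
    rewrite -(L2norm_sqrE (u m - u (m + k)%N)) lee_fin.
    rewrite lerXn2r ?nnegrE ?mulr_ge0 ?exprn_ge0 ?L2norm_ge0//.
    exact: L2norm_telescope.
  have lF0 (v : (\bar R)^nat) : (forall k, 0 <= v k)%E -> (0 <= limn_einf v)%E.
    move=> v0; rewrite limn_einf_lim; apply: lime_ge; first exact: is_cvg_einfs.
    by apply: nearW => k; apply: le_ereal_inf_tmp => _ [j _ <-].
  apply: (@le_trans _ _ (\int[mu]_x limn_einf (F ^~ x))%E).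
    apply: ae_ge0_le_integral => //.
    - by move=> x _; rewrite lee_fin sqr_ge0.
    - by apply/measurable_EFinP; apply: measurable_funX; exact: measurable_funB.
    - by move=> x _; exact: lF0.
    - under eq_fun do rewrite -[limn_einf _]oppeK -limn_esupN.
      apply: measurableT_comp => //.
      apply: measurable_realfun.measurable_fun_limn_esup => k.
      exact: measurableT_comp.
    - move: aecv; apply: filterS => x /fE cx _.
      suff /cvg_limn_einf_sup[-> _] : F ^~ x @ \oo --> ((u m x - f x) ^+ 2)%:E by [].
      apply: cvg_EFin; first exact: nearW.
      rewrite /comp /F/= expr2; under eq_fun do rewrite expr2.
      have H : (u m x - u (m + k)%N x) @[k --> \oo] --> u m x - f x.
        apply: cvgB; first exact: cvg_cst.
        by under eq_fun do rewrite addnC; move: cx; rewrite -(cvg_shiftn m).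
      exact: cvgM.
  apply: le_trans (fatou mu measurableT mF _) _ => //.
  rewrite limn_einf_lim; apply: lime_le; first exact: is_cvg_einfs.
  apply: nearW => k; apply: le_trans (iF k).
  by apply: ereal_inf_lbound; exists k => /=.
have Lf : f \in Lfun mu 2%:E.
  have H : (fun x => u 0%N x - f x) \in Lfun mu 2%:E.
    apply: L2_sqr_lty; first exact: measurable_funB.
    by apply: le_lt_trans (le 0%N) _; exact: ltry.
  have -> : f = (u 0%N : T -> R) - (fun x => u 0%N x - f x).
    by apply/funext => x; rewrite /GRing.add/GRing.opp/= opprB addrC subrK.
  have := LfunP (u 0%N - @Lfun_Sub _ _ _ _ _ (lee1n 2) _ H); by [].
exists (@Lfun_Sub _ _ _ _ _ (lee1n 2) _ Lf) => m.
rewrite -(ler_pXn2r (ltn0Sn 1)) ?nnegrE ?mulr_ge0 ?exprn_ge0 ?L2norm_ge0//.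
by rewrite -lee_fin L2norm_sqrE; exact: le.
Qed.

(** Expanding the square gives 2 t <q, v> <= t^2 |v|^2 for every t. Taking t = <q, v> / (|v|^2 + 1)
    forces <q, v> = 0; the added 1 keeps the denominator positive when [v] has norm zero. *)
Lemma L2_orth_minimal q v : (forall t : R, nm q <= nm (q - t *: v)) -> ip q v = 0.
Proof.
move=> qmin; set c := ip q v.
have H t : 2 * t * c <= t ^+ 2 * nm v ^+ 2.
  have : nm q ^+ 2 <= nm (q - t *: v) ^+ 2.
    by rewrite lerXn2r ?nnegrE ?L2norm_ge0.
  rewrite L2norm_sqrB ipZr -/c L2norm_scale exprMn real_normK ?num_real//.
  lra.
have v0 := sqr_ge0 (nm v); set a := nm v ^+ 2 in H v0.
apply/eqP; rewrite -sqrf_eq0; apply/eqP/le_anti; rewrite sqr_ge0 andbT.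
have a1 : 0 < a + 1 by lra.
have := H (c / (a + 1)).
rewrite -(ler_pM2r (exprn_gt0 2 a1)).
rewrite (_ : 2 * (c / (a + 1)) * c * (a + 1) ^+ 2 = 2 * c ^+ 2 * (a + 1)); last by field; lra.
rewrite (_ : (c / (a + 1)) ^+ 2 * a * (a + 1) ^+ 2 = c ^+ 2 * a); last by field; lra.
have := sqr_ge0 c; set b := c ^+ 2 => b0.
nra.
Qed.

(** Orthogonal projection onto the closure of [V], without forming the closure: a minimizing
    sequence in [V] converges to some [p], and q = f - p is orthogonal to [V]. Hence [q] is
    orthogonal to [f] by hypothesis and to [p] as a limit of elements of [V], so it has norm 0. *)
Lemma L2_double_orth_approx (V : set L2) f :
  V 0 -> (forall a v w, V v -> V w -> V (a *: v + w)) ->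
  (forall h, (forall v, V v -> ip v h = 0) -> ip f h = 0) ->
  forall e, 0 < e -> exists2 v, V v & nm (f - v) < e.
Proof.
move=> V0 VD fV e e0.
pose S := [set nm (f - v) ^+ 2 | v in V]; set dS := inf S.
have Sinf : has_inf S.
  split; first by exists (nm (f - 0) ^+ 2); exists 0.
  by exists 0 => _ [v _ <-]; exact: sqr_ge0.
have dle v : V v -> dS <= nm (f - v) ^+ 2.
  by move=> Vv; apply: ge_inf => //; [case: Sinf|exists v].
(* With this accuracy the parallelogram law gives |v_(k+1) - v_k|^2 <= 2 (eps_k + eps_(k+1)) <=
   (4^-k)^2, the rate that [L2_complete] requires. *)
pose eps k : R := (4^-1 ^+ k / 2) ^+ 2.
have /choice[v vP] : forall k, exists v : L2, V v /\ nm (f - v) ^+ 2 < dS + eps k.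
  move=> k; have ek : 0 < eps k by rewrite exprn_gt0// divr_gt0// exprn_gt0.
  by have [_ [v Vv <-] vd] := inf_adherent ek Sinf; exists v.
have Vv k : V (v k) by have [] := vP k.
have VB w k : V w -> V (v k + w) by move=> Vw; rewrite -[v k]scale1r; exact: VD.
have [p vp] : exists p : L2, forall m, nm (v m - p) <= 2 * 4^-1 ^+ m.
  apply: L2_complete => k.
  rewrite -(ler_pXn2r (ltn0Sn 1)) ?nnegrE ?exprn_ge0 ?L2norm_ge0//.
  have par : nm (v k.+1 - v k) ^+ 2 = 2 * nm (f - v k) ^+ 2 + 2 * nm (f - v k.+1) ^+ 2
      - 4 * nm (f - (2^-1 *: v k + 2^-1 *: v k.+1)) ^+ 2.
    rewrite !L2norm_sqrB !L2norm_sqr !(ipDr, ipDl, ipZr, ipZl) (ipC (v k.+1) (v k)).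
    by field.
  have := dle (2^-1 *: v k + 2^-1 *: v k.+1).
  have -> : 2^-1 *: v k + 2^-1 *: v k.+1 = 2^-1 *: v k + (2^-1 *: v k.+1 + 0) by rewrite addr0.
  move=> /(_ (VD _ _ _ (Vv _) (VD _ _ _ (Vv _) V0))); rewrite addr0.
  have [_ ] := vP k; have [_] := vP k.+1; rewrite /eps (exprS _ k).
  rewrite par; set x := nm (f - v k) ^+ 2; set y := nm (f - v k.+1) ^+ 2; set z := nm _ ^+ 2.
  move: (4^-1 ^+ k) => c; have := sqr_ge0 c; lra.
have vp' m : nm (p - v m) <= 2 * 4^-1 ^+ m by rewrite L2norm_distC.
set q : L2 := f - p.
have qmin w : V w -> nm q <= nm (q - w).
  (* With c = 4^-k, the 5 absorbs 2c from |v_k - p|, c/2 from the near-minimality of [v k], and 2c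
     from |p - v_k|. *)
  move=> Vw; apply: (@ler_add_expr4V _ _ _ 5) => k.
  have k0 : 0 <= (4^-1 : R) ^+ k by rewrite exprn_ge0.
  have := L2norm_dist_triangle (v k) f p; rewrite -/q.
  have : nm (f - (v k + w)) <= nm (q - w) + nm (p - v k).
    suff -> : f - (v k + w) = (q - w) + (p - v k) by exact: L2norm_triangle.
    by rewrite /q addrA (addrAC _ (- w) p) subrK opprD addrA addrAC.
  have [_ ] := vP k; have := dle _ (VB _ k Vw); have := vp k; have := vp' k.
  rewrite /eps; set x := nm (f - v k); set y := nm (f - _).
  set c := 4^-1 ^+ k in k0 *.
  have x0 : 0 <= x by exact: L2norm_ge0.
  have y0 : 0 <= y by exact: L2norm_ge0.
  move=> h1 h2 h3 h4 h5 h6.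
  have : x <= y + c / 2.
    have c0 : 0 <= c / 2 by rewrite divr_ge0.
    exact: (ler_add_sqr x0 y0 c0 h3 h4).
  lra.
have qV w : V w -> ip w q = 0.
  move=> Vw; rewrite ipC; apply: L2_orth_minimal => t; apply: qmin.
  by rewrite -[t *: w]addr0; exact: VD.
have q0 : nm q ^+ 2 = 0.
  have H k : nm q ^+ 2 = ip (v k - p) q.
    by rewrite L2norm_sqr {1}/q !ipBl (fV _ qV) (qV _ (Vv k)).
  apply/le_anti; rewrite sqr_ge0 andbT; apply: (@ler_add_expr4V _ _ _ (2 * nm q)) => k.
  rewrite add0r (H k); apply: le_trans (ler_norm _) _.
  apply: le_trans (L2_cauchy_schwarz _ _) _.
  by rewrite mulrAC ler_wpM2r ?L2norm_ge0.
have [k ke] := exists_expr4V_lt (divr_gt0 e0 (ltr0Sn R 1)).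
exists (v k) => //; apply: le_lt_trans (L2norm_dist_triangle p _ _) _.
move/eqP : q0; rewrite sqrf_eq0 => /eqP; rewrite -/q => ->; rewrite add0r.
by apply: le_lt_trans (vp' k) _; rewrite mulrC -ltr_pdivlMr.
Qed.

End L2_space.

(** * Integration on boxes *)

Section bounded_on.
Context d (T : measurableType d) (R : realType).
Implicit Types (D : set T) (f g : T -> R).

(** Integrals are normally taken over the whole space, and the domain is carried by the vanishing
    condition. When [D] has finite measure, this class is integrable and stable under sums and
    products, which settles the integrability side conditions. With [D = setT] it only says bounded
    and measurable. *)
Definition bounded_on D f := [/\ measurable_fun setT f,
  exists M, forall x, `|f x| <= M & forall x, ~ D x -> f x = 0].

Lemma bounded_onS D D' f : D `<=` D' -> bounded_on D f -> bounded_on D' f.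
Proof. by move=> DD' [mf fM f0]; split=> // x D'x; apply: f0 => /DD'. Qed.

Lemma bounded_onD D f g : bounded_on D f -> bounded_on D g ->
  bounded_on D (fun x => f x + g x).
Proof.
move=> [mf [M fM] f0] [mg [N gN] g0]; split.
- exact: measurable_funD.
- by exists (M + N) => x; apply: le_trans (ler_normD _ _) _; exact: lerD.
- by move=> x Dx; rewrite f0// g0// addr0.
Qed.

Lemma bounded_onM D f g : bounded_on D f -> measurable_fun setT g ->
  (exists M, forall x, `|g x| <= M) -> bounded_on D (fun x => f x * g x).
Proof.
move=> [mf [M fM] f0] mg [N gN]; split.
- exact: measurable_funM.
- by exists (M * N) => x; rewrite normrM; exact: ler_pM.
- by move=> x Dx; rewrite f0// mul0r.
Qed.

Lemma bounded_on_mul D f g : bounded_on D f -> bounded_on D g ->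
  bounded_on D (fun x => f x * g x).
Proof. by move=> bf [mg gM _]; exact: bounded_onM. Qed.

Lemma bounded_on_sqr D f : bounded_on D f -> bounded_on D (fun x => f x ^+ 2).
Proof. by move=> bf; apply: (bounded_on_mul bf bf). Qed.

Lemma bounded_onZ D f a : bounded_on D f -> bounded_on D (fun x => a * f x).
Proof.
move=> bf; under eq_fun do rewrite mulrC.
by apply: bounded_onM => //; exists `|a|.
Qed.

Lemma bounded_onB D f g : bounded_on D f -> bounded_on D g ->
  bounded_on D (fun x => f x - g x).
Proof.
move=> bf /(bounded_onZ (-1)) bg; have := bounded_onD bf bg.
by under eq_fun do rewrite mulN1r.
Qed.

Lemma bounded_on0 D : bounded_on D (fun=> 0).
Proof. by split=> //; exists 0 => x; rewrite normr0. Qed.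

Lemma bounded_on_sum D (I : Type) (r : seq I) (F : I -> T -> R) :
  (forall i, bounded_on D (F i)) -> bounded_on D (fun x => \sum_(i <- r) F i x).
Proof.
move=> bF; elim: r => [|i r IH].
  by under eq_fun do rewrite big_nil; exact: bounded_on0.
by under eq_fun do rewrite big_cons; exact: bounded_onD.
Qed.

Lemma bounded_on_indic D : measurable D -> bounded_on D (\1_D).
Proof.
move=> mD; split => //.
- by exists 1 => x; rewrite indicE; case: (_ \in _); rewrite ?normr1 ?normr0.
- by move=> x Dx; rewrite indicE memNset.
Qed.

Variable mu : {measure set T -> \bar R}.

Section integral.
Variable D : set T.
Hypotheses (mD : measurable D) (muD : (mu D < +oo)%E).

Lemma bounded_on_integrable f : bounded_on D f -> mu.-integrable setT (EFin \o f).
Proof.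
move=> [mf [M fM] f0].
have : mu.-integrable D (EFin \o f).
  apply: measurable_bounded_integrable => //; first exact: measurable_funS mf.
  exists M; split; first exact: num_real.
  by move=> N MN x Dx; exact: le_trans (fM x) (ltW MN).
rewrite (integrable_mkcond _ mD) => H; congr (mu.-integrable _ _): H.
apply/funext => x; rewrite patchE; case: ifPn => //.
by rewrite notin_setE => /f0 /= ->.
Qed.

Lemma bounded_on_Lfun2 f : bounded_on D f -> f \in Lfun mu 2%:E.
Proof.
move=> bf; have [mf _ _] := bf; apply: L2_sqr_lty => //.
have /integrableP[_] := bounded_on_integrable (bounded_on_sqr bf).
by under eq_integral do rewrite gee0_abs ?lee_fin ?sqr_ge0//.
Qed.

Lemma bounded_on_RintegralD f g : bounded_on D f -> bounded_on D g ->
  \int[mu]_x (f x + g x) = \int[mu]_x f x + \int[mu]_x g x.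
Proof. by move=> bf bg; apply: RintegralD => //; exact: bounded_on_integrable. Qed.

Lemma bounded_on_RintegralB f g : bounded_on D f -> bounded_on D g ->
  \int[mu]_x (f x - g x) = \int[mu]_x f x - \int[mu]_x g x.
Proof. by move=> bf bg; apply: RintegralB => //; exact: bounded_on_integrable. Qed.

Lemma bounded_on_RintegralZ f a : bounded_on D f ->
  \int[mu]_x (a * f x) = a * \int[mu]_x f x.
Proof. by move=> bf; apply: RintegralZl => //; exact: bounded_on_integrable. Qed.

Lemma bounded_on_Rintegral_sum (I : Type) (r : seq I) (F : I -> T -> R) :
  (forall i, bounded_on D (F i)) ->
  \int[mu]_x (\sum_(i <- r) F i x) = \sum_(i <- r) \int[mu]_x F i x.
Proof.
move=> bF; elim: r => [|i r IH].
  rewrite big_nil; under eq_Rintegral do rewrite big_nil.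
  by rewrite /Rintegral integral0.
rewrite big_cons -IH -bounded_on_RintegralD//; last exact: bounded_on_sum.
by under eq_Rintegral do rewrite big_cons.
Qed.

Lemma bounded_on_le_Rintegral f g : bounded_on D f -> bounded_on D g ->
  (forall x, f x <= g x) -> \int[mu]_x f x <= \int[mu]_x g x.
Proof.
by move=> bf bg fg; apply: le_Rintegral => //; exact: bounded_on_integrable.
Qed.

Lemma bounded_on_le_norm_Rintegral f M : bounded_on D f -> (forall x, `|f x| <= M) ->
  `|\int[mu]_x f x| <= M * fine (mu D).
Proof.
move=> bf fM; have [mf _ f0] := bf.
apply: le_trans (le_normr_Rintegral _ (bounded_on_integrable bf)) _ => //.
have -> : M * fine (mu D) = \int[mu]_x (M * \1_D x).
  rewrite bounded_on_RintegralZ//; last exact: bounded_on_indic.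
  rewrite -[fine _]mul1r -(Rintegral_cst mu mD) Rintegral_mkcond; congr (_ * _).
  by apply: eq_Rintegral => x _; rewrite patchE indicE; case: (_ \in _).
apply: bounded_on_le_Rintegral.
- split; [exact: measurableT_comp|by exists M => x; rewrite normr_id|].
  by move=> x /f0 ->; rewrite normr0.
- exact/bounded_onZ/bounded_on_indic.
- move=> x; rewrite indicE; have [_|] := boolP (x \in D); first by rewrite mulr1.
  by rewrite notin_setE => /f0 ->; rewrite normr0 mulr0.
Qed.

Lemma bounded_on_cauchy_schwarz f g : bounded_on D f -> bounded_on D g ->
  (\int[mu]_x (f x * g x)) ^+ 2 <= (\int[mu]_x f x ^+ 2) * (\int[mu]_x g x ^+ 2).
Proof.
move=> bf bg.
pose F := @Lfun_Sub _ _ _ _ _ (lee1n 2) _ (bounded_on_Lfun2 bf).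
pose G := @Lfun_Sub _ _ _ _ _ (lee1n 2) _ (bounded_on_Lfun2 bg).
have := L2_cauchy_schwarz F G.
rewrite -[in X in X -> _](ler_pXn2r (ltn0Sn 1)) ?nnegrE ?mulr_ge0 ?L2norm_ge0//.
rewrite real_normK ?num_real// exprMn !L2norm_sqr.
by congr (_ <= _ * _); apply: eq_Rintegral => x _; rewrite expr2.
Qed.

End integral.
End bounded_on.

(** * Fubini's theorem on boxes, splitting off the first coordinate *)

Section fubini_box.
Context (R : realType).
Local Notation leb := (@lebesgue_measure R).
Local Notation mu := (lebesgue_rV R).

Definition box n (L : R) : set 'rV[R]_n := [set x | forall i, - L <= x 0 i <= L].
Arguments box : clear implicits.

Definition seg (L : R) : set (measurableTypeR R) := `[- L, L]%classic.

Lemma measurable_seg L : measurable (seg L).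
Proof. exact: measurable_itv. Qed.

Lemma seg_lty L : (leb (seg L) < +oo)%E.
Proof. by rewrite /seg lebesgue_measure_itv/=; case: ifPn => _; rewrite ?ltry. Qed.

Lemma box_compact n L : compact (box n L).
Proof.
have := @rV_compact R n (fun=> `[- L, L]%classic) (fun=> @segment_compact _ _ _).
by congr compact; apply/seteqP; split => x /= H i; have := H i; rewrite in_itv.
Qed.

Lemma closed_box n L : closed (box n L).
Proof. by apply: compact_closed; [exact: norm_hausdorff|exact: box_compact]. Qed.

Lemma measurable_box n L : measurable (box n L).
Proof.
rewrite -[box n L]setCK; apply: measurableC; apply: open_measurable_rV.
exact/closed_openC/closed_box.
Qed.

Lemma box_lty n L : (mu n (box n L) < +oo)%E.
Proof.
have L0 : 0 <= `|L| by [].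
(* The volume formula needs ordered endpoints, whereas [L] may be negative. *)
apply: (@le_lt_trans _ _ (mu n (box n `|L|))).
  apply: le_measure; rewrite ?inE; [exact: measurable_box..|].
  move=> x xL i; have /andP[h1 h2] := xL i.
  apply/andP; split; last exact: le_trans h2 (ler_norm _).
  by apply: le_trans h1; rewrite lerN2 ler_norm.
have := @lebesgue_rV_box R n (const_mx (- `|L|)) (const_mx `|L|).
set B := (X in mu n X = _); have -> : B = box n `|L|.
  by apply/seteqP; split => x H i; have := H i; rewrite !mxE.
move=> ->; first exact: ltry.
by move=> i; rewrite !mxE; rewrite (@le_trans _ _ 0)// oppr_le0.
Qed.

Section sections.
Variables (n : nat) (L : R) (f : 'rV[R]_n.+1 -> R).
Hypothesis bf : bounded_on (box n.+1 L) f.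

Lemma box_cons (t : R) (y : 'rV[R]_n) :
  box n.+1 L (cons_rV (t, y)) <-> seg L t /\ box n L y.
Proof.
split=> [H|[Ht Hy] i].
  split=> [|i]; first by have := H ord0; rewrite cons_rV0/= /seg/= in_itv.
  by have := H (lift ord0 i); rewrite cons_rVS.
case: (unliftP ord0 i) => [k|] ->; first by rewrite cons_rVS; exact: Hy.
by rewrite cons_rV0; move: Ht; rewrite /seg/= in_itv.
Qed.

Let g (p : measurableTypeR R * 'rV[R]_n) := f (cons_rV p).

Let bg : bounded_on (seg L `*` box n L) g.
Proof.
have [mf [M fM] f0] := bf; split.
- by apply: measurableT_comp => //; exact: measurable_cons_rV.
- by exists M => x; exact: fM.
- by move=> [t y] ty; apply: f0 => /box_cons.
Qed.

Let ig : (leb \x mu n)%E.-integrable setT (EFin \o g).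
Proof.
apply: bounded_on_integrable bg.
  by apply: measurableX; [exact: measurable_seg|exact: measurable_box].
rewrite [ltLHS](product_measure1E leb (mu n) (measurable_seg L) (@measurable_box n L)).
by rewrite lte_mul_pinfty// ?ge0_fin_numE//; [exact: seg_lty|exact: box_lty].
Qed.

Lemma bounded_on_section1 (t : R) : bounded_on (box n L) (fun y => f (cons_rV (t, y))).
Proof.
have [mg [M gM] g0] := bg; split.
- exact: (measurableT_comp mg (pair1_measurable t)).
- by exists M => y; exact: (gM (t, y)).
- by move=> y yL; apply: (g0 (t, y)) => -[].
Qed.

Lemma bounded_on_section2 y : bounded_on (seg L) (fun t => f (cons_rV (t, y))).
Proof.
have [mg [M gM] g0] := bg; split.
- exact: (measurableT_comp mg (pair2_measurable y)).
- by exists M => t; exact: (gM (t, y)).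
- by move=> t tL; apply: (g0 (t, y)) => -[].
Qed.

Lemma bounded_on_fubini1 :
  bounded_on (seg L) (fun t => \int[mu n]_y f (cons_rV (t, y))).
Proof.
have [mg [M gM] g0] := bg; split.
- apply: measurableT_comp; first exact: fine_measurable.
  exact: (measurable_fubini_F ig).
- exists (M * fine (mu n (box n L))) => t.
  apply: bounded_on_le_norm_Rintegral; [exact: measurable_box|exact: box_lty| |].
    exact: bounded_on_section1.
  by move=> y; exact: (gM (t, y)).
- move=> t tL; rewrite (_ : (fun y => _) = cst 0) ?Rintegral_cst ?mul0r//.
  by apply/funext => y; apply: (g0 (t, y)) => -[].
Qed.

Lemma bounded_on_fubini2 :
  bounded_on (box n L) (fun y => \int[leb]_t f (cons_rV (t, y))).
Proof.
have [mg [M gM] g0] := bg; split.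
- apply: measurableT_comp; first exact: fine_measurable.
  exact: (measurable_fubini_G ig).
- exists (M * fine (leb (seg L))) => y.
  apply: bounded_on_le_norm_Rintegral; [exact: measurable_seg|exact: seg_lty| |].
    exact: bounded_on_section2.
  by move=> t; exact: (gM (t, y)).
- move=> y yL; rewrite (_ : (fun t => _) = cst 0) ?Rintegral_cst ?mul0r//.
  by apply/funext => t; apply: (g0 (t, y)) => -[].
Qed.

Let RintegralE : \int[mu n.+1]_x f x = fine (\int[leb \x mu n]_p (g p)%:E)%E.
Proof.
have [mf _ _] := bf.
rewrite /Rintegral /= /lebesgue_rV_step integral_pushforward//=.
- exact: measurable_cons_rV.
- exact/measurable_EFinP.
Qed.

(** This order leaves slices in the remaining coordinates inside, for inductions on the dimension;
    the order of [box_fubini2] leaves lines along the first coordinate inside, for one-dimensional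
    estimates. *)
Lemma box_fubini1 :
  \int[mu n.+1]_x f x = \int[leb]_t (\int[mu n]_y f (cons_rV (t, y))).
Proof.
rewrite RintegralE -(integral12_prod_meas1 ig); congr fine.
apply: eq_integral => t _; rewrite fineK//; apply: integrable_fin_num => //.
by apply: bounded_on_integrable (bounded_on_section1 t); [exact: measurable_box|exact: box_lty].
Qed.

Lemma box_fubini2 :
  \int[mu n.+1]_x f x = \int[mu n]_y (\int[leb]_t f (cons_rV (t, y))).
Proof.
rewrite RintegralE -(integral21_prod_meas1 ig); congr fine.
apply: eq_integral => y _; rewrite fineK//; apply: integrable_fin_num => //.
by apply: bounded_on_integrable (bounded_on_section2 y); [exact: measurable_seg|exact: seg_lty].
Qed.

End sections.
End fubini_box.
Arguments box {R} n L _.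

(** * Continuously differentiable functions vanishing off a box, and integration by parts *)

Lemma continuous_addf (R : realType) (T : topologicalType) (f g : T -> R) :
  continuous f -> continuous g -> continuous (fun x => f x + g x).
Proof. by move=> cf cg x; apply: cvgD; [exact: cf|exact: cg]. Qed.

Lemma continuous_mulf (R : realType) (T : topologicalType) (f g : T -> R) :
  continuous f -> continuous g -> continuous (fun x => f x * g x).
Proof. by move=> cf cg x; apply: cvgM; [exact: cf|exact: cg]. Qed.

Lemma continuous_subf (R : realType) (T : topologicalType) (f g : T -> R) :
  continuous f -> continuous g -> continuous (fun x => f x - g x).
Proof. by move=> cf cg x; apply: cvgB; [exact: cf|exact: cg]. Qed.

Lemma continuous_nonexpansive (R : realType) (T U : pseudoMetricType R) (f : T -> U) :
  (forall x y e, 0 < e -> ball x e y -> ball (f x) e (f y)) -> continuous f.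
Proof.
move=> fxy x; apply/cvg_ballP => e e0; apply/nbhs_ballP; exists e => // y.
exact: fxy.
Qed.

Section C1_on.
Context (R : realType).
Local Notation leb := (@lebesgue_measure R).
Local Notation mu := (lebesgue_rV R).

(** Vanishing off [D] stands for the Dirichlet condition: on a box it removes all boundary terms,
    and it passes to slices. *)
Definition C1_on n (D : set 'rV[R]_n) (f : 'rV[R]_n -> R) :=
  [/\ continuous f, forall x, ~ D x -> f x = 0 &
      forall i, (forall x, derivable f x (delta_mx 0 i)) /\ continuous (partial i f)].

Lemma continuous_bounded_on n L (f : 'rV[R]_n -> R) : continuous f ->
  (forall x, ~ box n L x -> f x = 0) -> bounded_on (box n L) f.
Proof.
move=> cf f0; split=> //; first exact: continuous_measurable_rV.
have /compact_bounded[M [_ fM]] : compact (f @` box n L).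
  apply: continuous_compact; last exact: box_compact.
  exact: continuous_subspaceT.
exists (`|M| + 1) => x; have [xL|/f0 ->] := pselect (box n L x); last first.
  by rewrite normr0 addr_ge0.
apply: (fM (`|M| + 1)); last by exists x.
by rewrite (le_lt_trans (ler_norm _))// ltrDl.
Qed.

Lemma partial_eq0_off n (D : set 'rV[R]_n) (f : 'rV[R]_n -> R) i : closed D ->
  (forall x, ~ D x -> f x = 0) -> forall x, ~ D x -> partial i f x = 0.
Proof.
move=> cD f0 x Dx; rewrite /partial (@near_eq_derive _ _ _ _ (cst 0)).
- exact: derive_cst.
- have : nbhs x (~` D) by apply: open_nbhs_nbhs; split=> //; exact: closed_openC.
  by apply: filterS => y /f0.
Qed.

Lemma C1_on_bounded n L (f : 'rV[R]_n -> R) : C1_on (box n L) f ->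
  bounded_on (box n L) f.
Proof. by move=> [cf f0 _]; exact: continuous_bounded_on. Qed.

Lemma C1_on_partial_bounded n L (f : 'rV[R]_n -> R) i : C1_on (box n L) f ->
  bounded_on (box n L) (partial i f).
Proof.
move=> [cf f0 /(_ i)[df cdf]]; apply: continuous_bounded_on => //.
by apply: partial_eq0_off => //; exact: closed_box.
Qed.

Lemma partialM n (f g : 'rV[R]_n -> R) i x :
  derivable f x (delta_mx 0 i) -> derivable g x (delta_mx 0 i) ->
  partial i (fun x => f x * g x) x = f x * partial i g x + g x * partial i f x.
Proof. by move=> df dg; rewrite /partial (deriveM df dg). Qed.

Lemma C1_onM n (D : set 'rV[R]_n) (f g : 'rV[R]_n -> R) : C1_on D f -> C1_on D g ->
  C1_on D (fun x => f x * g x).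
Proof.
move=> [cf f0 df] [cg g0 dg]; split.
- exact: continuous_mulf.
- by move=> x /f0 ->; rewrite mul0r.
- move=> i; have [dfi cdf] := df i; have [dgi cdg] := dg i; split.
    by move=> x; apply: derivableM.
  rewrite (_ : partial _ _ = (fun x => f x * partial i g x + g x * partial i f x)).
    by apply: continuous_addf; exact: continuous_mulf.
  by apply/funext => x; rewrite partialM.
Qed.

Lemma C1_onB n (D : set 'rV[R]_n) (f g : 'rV[R]_n -> R) : C1_on D f -> C1_on D g ->
  C1_on D (fun x => f x - g x).
Proof.
move=> [cf f0 df] [cg g0 dg]; split.
- exact: continuous_subf.
- by move=> x Dx; rewrite f0// g0// subr0.
- move=> i; have [dfi cdf] := df i; have [dgi cdg] := dg i; split.
    by move=> x; apply: derivableB.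
  rewrite (_ : partial _ _ = (fun x => partial i f x - partial i g x)).
    exact: continuous_subf.
  by apply/funext => x; rewrite /partial deriveB.
Qed.

Lemma continuous_cons_rVr n (t : R) : continuous (fun y : 'rV[R]_n => cons_rV (t, y)).
Proof.
apply: continuous_nonexpansive => y z e e0 yz.
by apply/cons_rV_ballE => //; split => //=; exact: ballxx.
Qed.

Lemma continuous_cons_rVl n (y : 'rV[R]_n) : continuous (fun t : R => cons_rV (t, y)).
Proof.
apply: continuous_nonexpansive => s t e e0 st.
by apply/cons_rV_ballE => //; split => //=; exact: ballxx.
Qed.

Lemma cons_rV_addr n (h t : R) (y : 'rV[R]_n) i :
  h *: delta_mx 0 (lift ord0 i) + cons_rV (t, y) = cons_rV (t, h *: delta_mx 0 i + y).
Proof.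
apply/rowP => j; rewrite [LHS]mxE; case: (unliftP ord0 j) => [k|] ->.
  by rewrite !cons_rVS !mxE/= (inj_eq lift_inj).
by rewrite !cons_rV0 !mxE/= mulr0 add0r.
Qed.

Lemma cons_rV_addl n (h t : R) (y : 'rV[R]_n) :
  h *: delta_mx 0 ord0 + cons_rV (t, y) = cons_rV (h + t, y).
Proof.
apply/rowP => j; rewrite [LHS]mxE; case: (unliftP ord0 j) => [k|] ->.
  by rewrite !cons_rVS !mxE/= mulr0 add0r.
by rewrite !cons_rV0 !mxE/= mulr1.
Qed.

Section sections.
Variables (n : nat) (L : R) (f : 'rV[R]_n.+1 -> R).
Hypothesis Cf : C1_on (box n.+1 L) f.

(** Equality of the difference quotients as functions of [h] transfers both the existence and the
    value of the derivative from [f] to its slices. *)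
Let quotient_section1 t i (y : 'rV[R]_n) :
  (fun h : R => h^-1 *: (((fun z => f (cons_rV (t, z))) \o shift y) (h *: delta_mx 0 i)
    - f (cons_rV (t, y)))) =
  (fun h : R => h^-1 *: ((f \o shift (cons_rV (t, y))) (h *: delta_mx 0 (lift ord0 i))
    - f (cons_rV (t, y)))).
Proof. by apply/funext => h /=; rewrite cons_rV_addr. Qed.

Let quotient_section2 (t : R) (y : 'rV[R]_n) :
  (fun h : R => h^-1 *: (((fun s : R => f (cons_rV (s, y))) \o shift t) (h *: 1)
    - f (cons_rV (t, y)))) =
  (fun h : R => h^-1 *: ((f \o shift (cons_rV (t, y))) (h *: delta_mx 0 ord0)
    - f (cons_rV (t, y)))).
Proof. by apply/funext => h /=; rewrite cons_rV_addl [h *: 1]mulr1. Qed.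

Lemma partial_section1 t i (y : 'rV[R]_n) :
  partial i (fun z => f (cons_rV (t, z))) y = partial (lift ord0 i) f (cons_rV (t, y)).
Proof. by rewrite /partial /derive quotient_section1. Qed.

Lemma C1_on_section1 t : C1_on (box n L) (fun y => f (cons_rV (t, y))).
Proof.
have [cf f0 df] := Cf; split.
- by move=> y; apply: continuous_comp; [exact: continuous_cons_rVr|exact: cf].
- by move=> y yL; apply: f0 => /box_cons[].
- move=> i; have [dfi cdf] := df (lift ord0 i); split.
    by move=> y; have := dfi (cons_rV (t, y)); rewrite /derivable quotient_section1.
  rewrite (_ : partial _ _ = (fun y => partial (lift ord0 i) f (cons_rV (t, y)))).
    by move=> y; apply: continuous_comp; [exact: continuous_cons_rVr|exact: cdf].
  by apply/funext => y; exact: partial_section1.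
Qed.

Lemma section2_derivable (t : R) y : derivable (fun s : R => f (cons_rV (s, y))) t 1.
Proof.
have [_ _ /(_ ord0)[dfi _]] := Cf.
by have := dfi (cons_rV (t, y)); rewrite /derivable quotient_section2.
Qed.

Lemma section2_derive1 (t : R) y :
  derive1 (fun s : R => f (cons_rV (s, y))) t = partial ord0 f (cons_rV (t, y)).
Proof. by rewrite derive1E /partial /derive quotient_section2. Qed.

Lemma section2_FTC (a b : R) y : a < b ->
  \int[leb]_(t in `[a, b]) partial ord0 f (cons_rV (t, y)) =
  f (cons_rV (b, y)) - f (cons_rV (a, y)).
Proof.
move=> ab; have [cf _ /(_ ord0)[_ cdf]] := Cf.
have cfy : continuous (fun s : R => f (cons_rV (s, y))).
  by move=> s; apply: continuous_comp; [exact: continuous_cons_rVl|exact: cf].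
rewrite /Rintegral (@continuous_FTC2 _ _ (fun s : R => f (cons_rV (s, y))))//.
- apply: continuous_subspaceT => s.
  by apply: continuous_comp; [exact: continuous_cons_rVl|exact: cdf].
- split.
  + by move=> s _; exact: section2_derivable.
  + by apply: cvg_at_right_filter; exact: cfy.
  + by apply: cvg_at_left_filter; exact: cfy.
- by move=> s _; rewrite section2_derive1.
Qed.

End sections.

(** Induction on the dimension: a derivative in a later coordinate is a derivative of slices, while
    in the first coordinate it integrates to a difference of two values taken outside the box. *)
Lemma Rintegral_partial n L (f : 'rV[R]_n -> R) i : C1_on (box n L) f ->
  \int[mu n]_x partial i f x = 0.
Proof.
elim: n f i => [f [] //|n IH f i Cf].
have bp := C1_on_partial_bounded _ Cf.
case: (unliftP ord0 i) => [k|] ->.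
  rewrite (box_fubini1 (bp _)).
  under eq_Rintegral => t _.
    under eq_Rintegral do rewrite -partial_section1.
    rewrite (IH _ _ (C1_on_section1 Cf t)); over.
  by rewrite /Rintegral integral0.
rewrite (box_fubini2 (bp _)).
under eq_Rintegral => y _.
  rewrite (_ : Rintegral _ _ _ = 0); first over.
  (* The [+ 1] puts both endpoints strictly outside the segment and keeps the interval nondegenerate
     even when [L] is 0 or negative. *)
  set M := `|L| + 1; have LM : - M < M by rewrite ltrNl gtrN ?ltr_pwDr.
  have f0 t : ~ seg L t -> f (cons_rV (t, y)) = 0.
    by have [_ f0 _] := Cf => tL; apply: f0 => /box_cons[].
  have ML : ~ seg L M /\ ~ seg L (- M).
    have := ler_norm L; rewrite /seg/= !in_itv/= /M => LL; split => /andP[]; lra.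
  transitivity (\int[leb]_(t in `[- M, M]) partial ord0 f (cons_rV (t, y))).
    rewrite [RHS]Rintegral_mkcond; apply: eq_Rintegral => t _; rewrite patchE.
    case: ifPn => //; rewrite notin_setE/= in_itv/= => tM.
    have [_ _ ->//] := bp ord0; move=> /box_cons[+ _].
    rewrite /seg/= in_itv/= => tL; apply: tM; have := ler_norm L; rewrite /M; lra.
  by rewrite (section2_FTC Cf)// !f0 ?subrr//; case: ML.
by rewrite /Rintegral integral0.
Qed.

Lemma Rintegral_by_parts n L (f g : 'rV[R]_n -> R) i :
  C1_on (box n L) f -> C1_on (box n L) g ->
  \int[mu n]_x (partial i f x * g x) = - \int[mu n]_x (f x * partial i g x).
Proof.
move=> Cf Cg; have := Rintegral_partial i (C1_onM Cf Cg).
have [_ _ /(_ i)[df _]] := Cf; have [_ _ /(_ i)[dg _]] := Cg.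
under eq_Rintegral do rewrite partialM//.
have mB := @measurable_box R n L; have Boo := @box_lty R n L.
have bf := C1_on_bounded Cf; have bg := C1_on_bounded Cg.
have bdf := C1_on_partial_bounded i Cf; have bdg := C1_on_partial_bounded i Cg.
rewrite (bounded_on_RintegralD mB Boo); [|exact: bounded_on_mul..].
under [X in _ + X]eq_Rintegral do rewrite mulrC.
lra.
Qed.

End C1_on.

(** * Friedrichs' inequality *)

Section friedrichs.
Context (R : realType).
Local Notation leb := (@lebesgue_measure R).
Local Notation mu := (lebesgue_rV R).

(** Half-open, so that adjacent cells tile an interval exactly, as in [sum_ind_co]. *)
Definition ind_co (a b : R) : measurableTypeR R -> R := \1_(`[a, b[%classic).

Lemma ind_coE a b t : ind_co a b t = ((a <= t) && (t < b))%:R.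
Proof.
rewrite /ind_co indicE; congr (_%:R); congr nat_of_bool.
by apply/idP/idP; rewrite inE/= in_itv.
Qed.

Lemma bounded_on_ind_co a b : bounded_on (`[a, b[%classic : set (measurableTypeR R)) (ind_co a b).
Proof. by apply: bounded_on_indic; exact: measurable_itv. Qed.

Lemma Rintegral_ind_co a b : a <= b -> \int[leb]_t ind_co a b t = b - a.
Proof.
move=> ab; rewrite /Rintegral integral_indic// setIT.
rewrite [X in fine X](lebesgue_measure_itv `[a, b[)/= lte_fin.
by case: ltP => //= ba; apply/esym/eqP; rewrite subr_eq0 eq_le ba ab.
Qed.

Lemma sum_ind_co (x : nat -> R) m t : {homo x : i j / (i <= j)%N >-> i <= j} ->
  \sum_(i < m) ind_co (x i) (x i.+1) t = ind_co (x 0%N) (x m) t.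
Proof.
move=> hx; elim: m => [|m IH].
  by rewrite big_ord0 ind_coE; case: leP => // xt; rewrite ltNge xt.
rewrite big_ord_recr/= IH !ind_coE.
have x0m := hx 0%N m isT; have xmm := hx m m.+1 (leqnSn m).
case: (leP (x 0%N) t) => x0t /=; last first.
  by rewrite (lt_geF (lt_le_trans x0t x0m))/= addr0.
case: (ltP t (x m)) => xmt /=; last by rewrite add0r.
by rewrite addr0 (lt_le_trans xmt xmm).
Qed.

(* Double integration of [(c t - c s) ^+ 2 <= `|t - s| * E] over the square. *)
Lemma poincare_interval (c : R -> R) (D : set (measurableTypeR R)) (a b E : R) :
  measurable D -> (leb D < +oo)%E -> bounded_on D c -> a < b ->
  (forall s t, (c t - c s) ^+ 2 <= `|t - s| * E) ->
  \int[leb]_t (c t ^+ 2 * ind_co a b t) <=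
  (b - a)^-1 * (\int[leb]_t (c t * ind_co a b t)) ^+ 2 + (b - a) ^+ 2 * E.
Proof.
move=> mD Doo bc ab cE; set A := leLHS; set B := \int[leb]_t (c t * _).
set h := b - a; have h0 : 0 < h by rewrite subr_gt0.
pose K : set (measurableTypeR R) := D `|` `[a, b[%classic.
have mK : measurable K by apply: measurableU => //; exact: measurable_itv.
have Koo : (leb K < +oo)%E.
  have /le_lt_trans := measureU2 leb mD (measurable_itv `[a, b[).
  apply; apply: lte_add_pinfty => //.
  by rewrite [ltLHS](lebesgue_measure_itv `[a, b[)/=; case: ifPn => _; rewrite ltry.
have bK : bounded_on K c by apply: bounded_onS bc => ? ?; left.
have bi : bounded_on K (ind_co a b).
  by apply: bounded_onS (bounded_on_ind_co a b) => ? ?; right.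
have bK2 := bounded_on_sqr bK.
have bci := bounded_on_mul bK bi; have bc2i := bounded_on_mul bK2 bi.
have E0 : 0 <= E.
  by have := cE a b; rewrite gtr0_norm// => /(le_trans (sqr_ge0 _)); rewrite pmulr_rge0.
(* First integration, in [s] with [t] fixed; [A] and [B] are the integrals of c^2 and c over the
   interval. *)
have H1 t : a <= t < b -> h * c t ^+ 2 - 2 * B * c t + A <= h ^+ 2 * E.
  move=> /andP[at_ tb].
  have -> : h * c t ^+ 2 - 2 * B * c t + A =
      \int[leb]_s (c t ^+ 2 * ind_co a b s + (- 2 * c t) * (c s * ind_co a b s)
        + c s ^+ 2 * ind_co a b s).
    rewrite (bounded_on_RintegralD mK Koo)//; last first.
      by apply: bounded_onD; exact: bounded_onZ.
    rewrite (bounded_on_RintegralD mK Koo); [|exact: bounded_onZ..].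
    rewrite !(bounded_on_RintegralZ mK Koo)// (Rintegral_ind_co (ltW ab)) -/A -/B -/h.
    ring.
  have -> : h ^+ 2 * E = \int[leb]_s (h * E * ind_co a b s).
    by rewrite (bounded_on_RintegralZ mK Koo)// (Rintegral_ind_co (ltW ab)) -/h; ring.
  apply: (bounded_on_le_Rintegral mK Koo).
  - by apply: bounded_onD => //; apply: bounded_onD; exact: bounded_onZ.
  - exact: bounded_onZ.
  - move=> s; rewrite ind_coE.
    have [/andP[as_ sb]|_] := boolP ((a <= s) && (s < b)); last first.
      by rewrite !mulr0 !addr0.
    have : `|t - s| <= h by rewrite ler_norml /h; lra.
    move=> /(ler_wpM2r E0); have := cE s t; rewrite /= mulr1n; lra.
have : \int[leb]_t (h * (c t ^+ 2 * ind_co a b t) +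
      (- 2 * B) * (c t * ind_co a b t) + A * ind_co a b t)
    <= \int[leb]_t (h ^+ 2 * E * ind_co a b t).
  apply: (bounded_on_le_Rintegral mK Koo).
  - by apply: bounded_onD; [apply: bounded_onD|]; exact: bounded_onZ.
  - exact: bounded_onZ.
  - move=> t; rewrite ind_coE.
    have [/H1|_] := boolP ((a <= t) && (t < b)); last by rewrite !mulr0 !addr0.
    by rewrite !mulr1; lra.
rewrite (bounded_on_RintegralD mK Koo);
  [|by apply: bounded_onD; exact: bounded_onZ|exact: bounded_onZ].
rewrite (bounded_on_RintegralD mK Koo); [|exact: bounded_onZ..].
rewrite !(bounded_on_RintegralZ mK Koo)// (Rintegral_ind_co (ltW ab)) -/A -/B -/h => H.
(* [H] amounts to 2 h A - 2 B^2 <= h^3 E, so half of the last term of the claim is given away. *)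
rewrite -(ler_pM2l h0) mulrDr mulrA divff ?gt_eqF// mul1r.
have : 0 <= h ^+ 2 * E * h by rewrite !mulr_ge0 ?exprn_ge0 ?(ltW h0).
rewrite (_ : h * (h ^+ 2 * E) = h ^+ 2 * E * h); last by ring.
lra.
Qed.

(** Piecewise averages: [-M, M[ is cut into [m] cells of length [h], and [poincare_interval] is
    applied on each. The factor h^(-1/2) normalizes the cell indicators in L^2, so that the squared
    pairings enter with coefficient 1. *)
Lemma step_weights (L e : R) : 0 < e ->
  exists (m : nat) (v : 'I_m -> measurableTypeR R -> R),
    (forall a, bounded_on setT (v a)) /\
    forall (c : R -> R) (E : R), bounded_on (seg L) c -> 0 <= E ->
      (forall s t, (c t - c s) ^+ 2 <= `|t - s| * E) ->
      \int[leb]_t c t ^+ 2 <= \sum_a (\int[leb]_t (c t * v a t)) ^+ 2 + e * E.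
Proof.
move=> e0; pose M := `|L| + 1.
have M0 : 0 < M by rewrite ltr_wpDl.
(* The [m] cells produce a total error m h^2 E = 4 M^2 4^-k E, which this [k] makes at most e E. *)
have [k ke] := exists_expr4V_lt (divr_gt0 e0 (mulr_gt0 (ltr0n R 4) (mulr_gt0 M0 M0))).
pose m := (4 ^ k)%N; pose h : R := 2 * M * 4^-1 ^+ k.
have h0 : 0 < h by rewrite /h !mulr_gt0// exprn_gt0.
have mh : m%:R * h = 2 * M.
  by rewrite /m natrX /h mulrCA -exprMn mulfV// expr1n mulr1.
pose x (i : nat) : R := - M + i%:R * h.
have xS i : x i.+1 - x i = h by rewrite /x -addn1 natrD; ring.
exists m, (fun a t => (Num.sqrt h)^-1 * ind_co (x a) (x a.+1) t); split.
  by move=> a; apply: bounded_onZ; apply: bounded_onS (bounded_on_ind_co _ _).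
move=> c E bc E0 cE.
have mD := measurable_seg L; have Doo := seg_lty L.
have bi a : exists N, forall t, `|ind_co (x a) (x a.+1) t| <= N.
  by have [_ ? _] := bounded_on_ind_co (x a) (x a.+1).
have mi a : measurable_fun setT (ind_co (x a) (x a.+1)).
  by have [? _ _] := bounded_on_ind_co (x a) (x a.+1).
have -> : \int[leb]_t c t ^+ 2 =
    \sum_(a < m) \int[leb]_t (c t ^+ 2 * ind_co (x a) (x a.+1) t).
  rewrite -(bounded_on_Rintegral_sum mD Doo); last first.
    by move=> a; apply: bounded_onM => //; exact: bounded_on_sqr.
  apply: eq_Rintegral => t _; rewrite -mulr_sumr sum_ind_co; last first.
    by move=> i j ij; rewrite /x lerD2l ler_wpM2r ?ler_nat// ltW.
  have [tL|tL] := pselect (seg L t); last first.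
    by have [_ _ c0] := bc; rewrite (c0 _ tL) expr0n/= mul0r.
  rewrite ind_coE /x mul0r mh addr0 (_ : _ && _) ?mulr1//.
  move: tL; rewrite /seg/= in_itv/= => /andP[t1 t2].
  have := ler_norm L; rewrite /M; lra.
apply: (@le_trans _ _ (\sum_(a < m)
    ((\int[leb]_t (c t * ((Num.sqrt h)^-1 * ind_co (x a) (x a.+1) t))) ^+ 2 + h ^+ 2 * E))).
  apply: ler_sum => a _.
  apply: le_trans (poincare_interval mD Doo bc _ cE) _; first by rewrite -subr_gt0 xS.
  rewrite xS lerD2r; under [in leRHS]eq_Rintegral do rewrite mulrCA.
  rewrite (bounded_on_RintegralZ mD Doo); last by apply: bounded_onM.
  by rewrite exprMn exprVn sqr_sqrtr// ltW.
rewrite big_split/= lerD2l sumr_const card_ord -mulr_natl mulrA ler_wpM2r//.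
rewrite expr2 mulrA mh /h; move: ke; rewrite ltr_pdivlMr ?mulr_gt0//.
lra.
Qed.

(** The increment is the integral of the derivative against the indicator of [s, t[, whose squared
    L^2 norm is t - s; Cauchy-Schwarz concludes. *)
Lemma section2_holder n L (f : 'rV[R]_n.+1 -> R) y s t : C1_on (box n.+1 L) f ->
  (f (cons_rV (t, y)) - f (cons_rV (s, y))) ^+ 2 <=
  `|t - s| * \int[leb]_r (partial ord0 f (cons_rV (r, y)) ^+ 2).
Proof.
move=> Cf; wlog st : s t / s < t => [hw|].
  have [/hw//|/hw|->] := ltgtP s t.
    by rewrite distrC -sqrrN opprB.
  by rewrite !subrr expr0n normr0 mul0r.
rewrite gtr0_norm ?subr_gt0//.
(* An interval containing both [s, t] and the support of the derivative, as [s] and [t] may lie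
   outside the box. *)
pose M := `|L| + `|s| + `|t|.
have [mM Moo] := (measurable_seg M, seg_lty M).
have sM : `[s, t[%classic `<=` seg M.
  move=> r /=; rewrite /seg/= !in_itv/= /M => /andP[sr rt].
  have := ler_norm t; have := ler_norm (- s); rewrite normrN.
  have := normr_ge0 L; have := normr_ge0 s; have := normr_ge0 t; lra.
have LM : seg L `<=` seg M.
  move=> r /=; rewrite /seg/= !in_itv/= /M => /andP[Lr rL].
  have := ler_norm L; have := normr_ge0 s; have := normr_ge0 t; lra.
have bi := bounded_onS sM (bounded_on_ind_co s t).
have bp := bounded_onS LM (bounded_on_section2 (C1_on_partial_bounded ord0 Cf) y).
have -> : f (cons_rV (t, y)) - f (cons_rV (s, y)) =
    \int[leb]_r (partial ord0 f (cons_rV (r, y)) * ind_co s t r).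
  rewrite -(section2_FTC Cf)// -Rintegral_itv_bndo_bndc; last first.
    by apply: integrableS (bounded_on_integrable mM Moo bp).
  rewrite Rintegral_mkcond; apply: eq_Rintegral => r _.
  by rewrite patchE /ind_co indicE; case: (_ \in _); rewrite ?mulr1 ?mulr0.
apply: le_trans (bounded_on_cauchy_schwarz mM Moo bp bi) _.
rewrite mulrC ler_wpM2r ?Rintegral_ge0//; first by move=> *; exact: sqr_ge0.
rewrite (_ : (fun r => _) = ind_co s t) ?(Rintegral_ind_co (ltW st))//.
by apply/funext => r; rewrite ind_coE; case: (_ && _); rewrite ?expr1n ?expr0n.
Qed.

(** Pairing slices with a weight in the other variables keeps the Hoelder bound of exponent 1/2:
    Cauchy-Schwarz in [y], then [section2_holder] on each line. *)
Lemma section1_holder n L (f : 'rV[R]_n.+1 -> R) (w : 'rV[R]_n -> R) C s t :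
  C1_on (box n.+1 L) f -> measurable_fun setT w -> (forall y, `|w y| <= C) ->
  (\int[mu n]_y (f (cons_rV (t, y)) * w y) - \int[mu n]_y (f (cons_rV (s, y)) * w y)) ^+ 2
  <= `|t - s| * (C ^+ 2 * fine (mu n (box n L)) *
       \int[mu n.+1]_x (partial ord0 f x ^+ 2)).
Proof.
move=> Cf mw wC; have [mB Boo] := (@measurable_box R n L, box_lty n L).
have bf r := bounded_on_section1 (C1_on_bounded Cf) r.
have bp2 := bounded_on_sqr (C1_on_partial_bounded ord0 Cf).
(* The weight is only bounded, so it is cut off to the box, where the slices live, to become square
   integrable. *)
have bw : bounded_on (box n L) (fun y => w y * \1_(box n L) y).
  under eq_fun do rewrite mulrC; apply: bounded_onM => //; last by exists C.
  exact: bounded_on_indic.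
have bfw r : bounded_on (box n L) (fun y => f (cons_rV (r, y)) * w y).
  by apply: bounded_onM => //; exists C.
rewrite -(bounded_on_RintegralB mB Boo)//.
have -> : \int[mu n]_y (f (cons_rV (t, y)) * w y - f (cons_rV (s, y)) * w y) =
    \int[mu n]_y ((f (cons_rV (t, y)) - f (cons_rV (s, y))) * (w y * \1_(box n L) y)).
  apply: eq_Rintegral => y _; have [yL|yL] := pselect (box n L y).
    by rewrite indicE mem_set// mulr1 mulrBl.
  have [_ _ f0] := bf t; have [_ _ g0] := bf s.
  by rewrite (f0 _ yL) (g0 _ yL) !mul0r subrr mul0r.
rewrite [leRHS](_ : _ = (`|t - s| * \int[mu n.+1]_x (partial ord0 f x ^+ 2)) *
  (C ^+ 2 * fine (mu n (box n L)))); last by ring.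
apply: le_trans (bounded_on_cauchy_schwarz mB Boo (bounded_onB (bf t) (bf s)) bw) _.
have fB0 : 0 <= fine (mu n (box n L)) by rewrite fine_ge0.
have bp2y : bounded_on (box n L) (fun y => \int[leb]_r (partial ord0 f (cons_rV (r, y)) ^+ 2)).
  exact: (bounded_on_fubini2 bp2).
rewrite ler_pM ?Rintegral_ge0//.
- by move=> *; exact: sqr_ge0.
- by move=> *; exact: sqr_ge0.
- rewrite (box_fubini2 bp2) -(bounded_on_RintegralZ mB Boo)//.
  apply: (bounded_on_le_Rintegral mB Boo).
  + by apply: bounded_on_sqr; exact: bounded_onB.
  + exact: bounded_onZ.
  + by move=> y; exact: (section2_holder y s t Cf).
- apply: le_trans (ler_norm _) _.
  apply: (bounded_on_le_norm_Rintegral mB Boo); first exact: bounded_on_sqr.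
  move=> y; rewrite normrX lerXn2r ?nnegrE// ?(le_trans _ (wC y))//.
  rewrite normrM indicE; case: (_ \in _); first by rewrite normr1 mulr1.
  by rewrite normr0 mulr0.
Qed.

(** Induction on the dimension. On each slice the induction hypothesis leaves finitely many
    coefficients c_j(t); these are Hoelder in t by [section1_holder], so [step_weights] reduces each
    of them to finitely many numbers. The new weights are products of slice weights and interval
    weights. *)
Lemma friedrichs n L e : 0 < e ->
  exists (I : finType) (w : I -> 'rV[R]_n -> R),
    (forall j, bounded_on setT (w j)) /\
    forall f, C1_on (box n L) f ->
      \int[mu n]_x f x ^+ 2 <= \sum_j (\int[mu n]_x (f x * w j x)) ^+ 2 +
        e * \sum_i \int[mu n]_x (partial i f x ^+ 2).
Proof.
elim: n e => [|n IH] e e0.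
  (* In dimension 0 the measure is a Dirac mass, so the single weight 1 gives equality. *)
  exists unit, (fun _ _ => 1); split.
    move=> _; split=> [||x /(_ I)//]; first exact: measurable_cst.
    by exists 1 => x; rewrite normr1.
  move=> f _; rewrite big_ord0 mulr0 addr0.
  have H (g : 'rV[R]_0 -> R) : \int[mu 0]_x g x = g 0.
    have mg : measurable_fun setT g.
      by apply: continuous_measurable_rV; apply: continuous_nonexpansive => x y r r0 _;
         rewrite (_ : x = y); [exact: ballxx|apply/rowP => -[]].
    rewrite /Rintegral integral_dirac//; last exact/measurable_EFinP.
    by rewrite diracT mul1e.
  rewrite H big_const card_unit/= addr0 H mulr1//.
have [J [w [bw wf]]] := IH e e0.
have /choice[C wC] : forall j, exists C, forall y, `|w j y| <= C by move=> j; have [] := bw j.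
have mw j : measurable_fun setT (w j) by have [] := bw j.
pose B := fine (mu n (box n L)).
have B0 : 0 <= B by rewrite fine_ge0.
(* The Hoelder constants [E j] below add up to (K - 1) G, so accuracy e / K in [step_weights] costs
   at most e G in total; the added 1 keeps [K] positive. *)
pose K := \sum_j (C j ^+ 2 * B) + 1.
have K0 : 0 < K.
  by rewrite ltr_wpDl// sumr_ge0// => j _; rewrite mulr_ge0// sqr_ge0.
have [m [v [bv vf]]] := step_weights L (divr_gt0 e0 K0).
pose W (p : J * 'I_m) (x : 'rV[R]_n.+1) := w p.1 (uncons_rV x).2 * v p.2 (uncons_rV x).1.
have bW p : bounded_on setT (W p).
  have [mw1 [C1 C1P] _] := bw p.1; have [mv1 [C2 C2P] _] := bv p.2; split=> [||x /(_ I)//].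
    have muncons := @measurable_uncons_rV R n.
    apply: measurable_funM.
      by apply: measurableT_comp => //; apply: measurableT_comp muncons.
    by apply: measurableT_comp => //; apply: measurableT_comp muncons.
  by exists (C1 * C2) => x; rewrite normrM ler_pM.
exists (J * 'I_m)%type, W; split => // f Cf.
have [mL Loo] := (measurable_seg L, seg_lty L).
have bf := C1_on_bounded Cf; have bf2 := bounded_on_sqr bf.
have bp i := C1_on_partial_bounded i Cf.
have bp2 i := bounded_on_sqr (bp i).
pose c j (t : R) := \int[mu n]_y (f (cons_rV (t, y)) * w j y).
have bfw j : bounded_on (box n.+1 L) (fun x => f x * w j (uncons_rV x).2).
  apply: bounded_onM => //; last by exists (C j).
  by apply: measurableT_comp => //; apply: measurableT_comp (@measurable_uncons_rV R n).
have bc j : bounded_on (seg L) (c j).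
  have := bounded_on_fubini1 (bfw j); congr bounded_on; apply/funext => t.
  by apply: eq_Rintegral => y _; rewrite cons_rVK.
pose G := \int[mu n.+1]_x (partial ord0 f x ^+ 2).
have G0 : 0 <= G by apply: Rintegral_ge0 => x _; exact: sqr_ge0.
pose E j := C j ^+ 2 * B * G.
have E0 j : 0 <= E j.
  by apply: mulr_ge0 => //; apply: mulr_ge0 => //; exact: sqr_ge0.
have cE j s t : (c j t - c j s) ^+ 2 <= `|t - s| * E j.
  by apply: section1_holder => //; exact: wC.
have cW j a : \int[leb]_t (c j t * v a t) = \int[mu n.+1]_x (f x * W (j, a) x).
  rewrite (@box_fubini1 _ _ L); last by apply: bounded_onM => //; have [] := bW (j, a).
  apply: eq_Rintegral => t _; rewrite /c mulrC.
  rewrite -(bounded_on_RintegralZ (@measurable_box R n L) (box_lty n L)).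
    by apply: eq_Rintegral => y _; rewrite /W cons_rVK/= mulrCA; congr (_ * _); rewrite mulrC.
  by apply: bounded_onM => //; [exact: bounded_on_section1|exists (C j)].
apply: (@le_trans _ _ (\sum_j \int[leb]_t c j t ^+ 2 +
    e * \sum_i \int[mu n.+1]_x (partial (lift ord0 i) f x ^+ 2))).
  rewrite (box_fubini1 bf2) -(bounded_on_Rintegral_sum mL Loo); last first.
    by move=> j; exact: bounded_on_sqr.
  under [X in e * X]eq_bigr => i _ do rewrite (box_fubini1 (bp2 (lift ord0 i))).
  have bs i : bounded_on (seg L)
      (fun t => \int[mu n]_y (partial (lift ord0 i) f (cons_rV (t, y)) ^+ 2)).
    exact: (bounded_on_fubini1 (bp2 (lift ord0 i))).
  rewrite -(bounded_on_Rintegral_sum mL Loo)// -(bounded_on_RintegralZ mL Loo); last first.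
    exact: bounded_on_sum.
  rewrite -(bounded_on_RintegralD mL Loo); last 2 first.
  - by apply: bounded_on_sum => j; exact: bounded_on_sqr.
  - by apply: bounded_onZ; exact: bounded_on_sum.
  apply: (bounded_on_le_Rintegral mL Loo).
  - exact: (bounded_on_fubini1 bf2).
  - apply: bounded_onD; first by apply: bounded_on_sum => j; exact: bounded_on_sqr.
    by apply: bounded_onZ; exact: bounded_on_sum.
  - move=> t; apply: le_trans (wf _ (C1_on_section1 Cf t)) _.
    apply: lerD; first exact: lexx.
    apply: ler_wpM2l; first exact: ltW.
    apply: ler_sum => i _; rewrite le_eqVlt; apply/orP; left; apply/eqP.
    by apply: eq_Rintegral => y _; rewrite (partial_section1 f).
apply: (@le_trans _ _ (\sum_j (\sum_a (\int[leb]_t (c j t * v a t)) ^+ 2 + e / K * E j) +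
    e * \sum_i \int[mu n.+1]_x (partial (lift ord0 i) f x ^+ 2))).
  by rewrite lerD2r ler_sum// => j _; exact: vf.
rewrite big_split/= pair_big/= big_ord_recl mulrDr addrA lerD2r.
rewrite [leRHS](_ : _ =
  \sum_(p : J * 'I_m) (\int[leb]_t (c p.1 t * v p.2 t)) ^+ 2 + e * G); last first.
  by congr (_ + _); apply: eq_bigr => -[j a] _; rewrite cW.
rewrite lerD2l -mulr_sumr -mulr_suml mulrA mulrAC -mulrA.
rewrite -[leLHS]mulrA ler_wpM2l ?(ltW e0)//.
by rewrite mulrCA ler_piMr// mulrC ler_pdivrMr// mul1r /K lerDl.
Qed.

End friedrichs.

(** * A priori bounds for test functions *)

Section smooth_functions.
Context (R : realType) (n : nat).
Implicit Types (f g : 'rV[R]_n -> R) (D : set 'rV[R]_n).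

Lemma smooth_partial i f : smooth f -> smooth (partial i f).
Proof.
move=> sf s; have := sf (rcons s i).
by rewrite /iter_partial foldr_rcons.
Qed.

Lemma smooth_derivable f x i : smooth f -> derivable f x (delta_mx 0 i).
Proof. by move=> /(_ [::])[_]; apply. Qed.

Lemma smooth_continuous f : smooth f -> continuous f.
Proof. by move=> /(_ [::])[]. Qed.

Lemma partial_lin i f g a : smooth f -> smooth g ->
  partial i (fun x => a * f x + g x) = fun x => a * partial i f x + partial i g x.
Proof.
move=> sf sg; apply/funext => x; rewrite /partial.
have df := @smooth_derivable f x i sf; have dg := @smooth_derivable g x i sg.
by rewrite (deriveD (derivableZ df) dg) deriveZ.
Qed.

Lemma smooth_lin f g a : smooth f -> smooth g -> smooth (fun x => a * f x + g x).
Proof.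
move=> sf sg s.
have -> : iter_partial s (fun x => a * f x + g x) =
    fun x => a * iter_partial s f x + iter_partial s g x.
  elim: s => [//|i s IH] /=; rewrite /iter_partial/= -/(iter_partial _ _) IH.
  apply: partial_lin.
    by move=> t; have := sf (t ++ s); rewrite /iter_partial foldr_cat.
  by move=> t; have := sg (t ++ s); rewrite /iter_partial foldr_cat.
have [cf df] := sf s; have [cg dg] := sg s; split.
  apply: continuous_addf; last exact: cg.
  by apply: continuous_mulf; [exact: cst_continuous|exact: cf].
by move=> i x; apply: derivableD; [exact: derivableZ|].
Qed.

Lemma smooth0 : smooth (fun _ : 'rV[R]_n => 0 : R).
Proof.
have H s : iter_partial s (fun _ : 'rV[R]_n => 0 : R) = fun=> 0.
  elim: s => [//|i s IH]; rewrite /iter_partial/= -/(iter_partial _ _) IH.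
  by apply/funext => x; exact: derive_cst.
by move=> s; rewrite H; split=> [|i x]; [exact: cst_continuous|exact: derivable_cst].
Qed.

Lemma smooth_sum (I : Type) (r : seq I) (F : I -> 'rV[R]_n -> R) :
  (forall i, smooth (F i)) -> smooth (fun x => \sum_(i <- r) F i x).
Proof.
move=> sF; elim: r => [|i r IH].
  by under eq_fun do rewrite big_nil; exact: smooth0.
under eq_fun do rewrite big_cons -[F i _]mul1r.
exact: smooth_lin.
Qed.

Lemma smooth_laplacian f : smooth f -> smooth (laplacian f).
Proof. by move=> sf; apply: smooth_sum => i; do 2 apply: smooth_partial. Qed.

Lemma laplacian_lin f g a : smooth f -> smooth g ->
  laplacian (fun x => a * f x + g x) = fun x => a * laplacian f x + laplacian g x.
Proof.
move=> sf sg; apply/funext => x; rewrite /laplacian mulr_sumr -big_split/=.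
apply: eq_bigr => i _.
by rewrite (partial_lin _ _ sf sg) (partial_lin _ _ (smooth_partial i sf) (smooth_partial i sg)).
Qed.

Lemma bilaplacian_lin f g a : smooth f -> smooth g ->
  bilaplacian (fun x => a * f x + g x) =
  fun x => a * bilaplacian f x + bilaplacian g x.
Proof.
move=> sf sg; by rewrite /bilaplacian (laplacian_lin _ sf sg)
  (laplacian_lin _ (smooth_laplacian sf) (smooth_laplacian sg)).
Qed.

Lemma laplacian_eq0_off D f : closed D -> (forall x, ~ D x -> f x = 0) ->
  forall x, ~ D x -> laplacian f x = 0.
Proof.
move=> cD f0 x Dx; rewrite /laplacian big1// => i _.
by rewrite (@partial_eq0_off R n D (partial i f) i cD (@partial_eq0_off R n D f i cD f0)).
Qed.

Lemma smooth_C1_on D f : smooth f -> (forall x, ~ D x -> f x = 0) -> C1_on D f.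
Proof.
move=> sf f0; split => //; first exact: smooth_continuous.
move=> i; split; first by move=> x; exact: smooth_derivable.
exact/smooth_continuous/smooth_partial.
Qed.

Lemma supp_eq0 f x : ~ supp f x -> f x = 0.
Proof.
by move=> fx; apply/eqP/negP => /negP fx0; apply: fx; exact: subset_closure.
Qed.

Lemma test_function_lin D f g a : test_function D f -> test_function D g ->
  test_function D (fun x => a * f x + g x).
Proof.
move=> [sf kf fD] [sg kg gD].
have sub : supp (fun x => a * f x + g x) `<=` supp f `|` supp g.
  rewrite [X in _ `<=` X](closure_id _).1; last first.
    by apply: closedU; exact: closed_closure.
  apply: closureS => x /= fgx; apply: contrapT => /not_orP[/supp_eq0 fx /supp_eq0 gx].
  by move: fgx; rewrite fx gx mulr0 addr0 eqxx.
split; first exact: smooth_lin.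
- apply: subclosed_compact sub; first exact: closed_closure.
  exact: compactU.
- by move=> x /sub [/fD|/gD].
Qed.

End smooth_functions.

(** One factor is cancelled twice: D^2 <= P N <= C P D gives D <= C P, then P^2 <= N Q <= C D Q <=
    C^2 P Q gives P <= C^2 Q. *)
Lemma interpolation_chain (R : realFieldType) (C N D P Q : R) :
  0 <= C -> 0 <= D -> 0 <= P -> 0 <= Q ->
  N <= C * D -> D ^+ 2 <= P * N -> P ^+ 2 <= N * Q -> D <= C ^+ 3 * Q.
Proof.
move=> C0 D0 P0 Q0 ND DPN PNQ.
(* A zero factor cannot be cancelled, but then the conclusion is the sign of [b]. *)
have cancel (a b : R) : 0 <= a -> 0 <= b -> a ^+ 2 <= a * b -> a <= b.
  by rewrite le_eqVlt => /predU1P[<- //|a0] _; rewrite expr2 ler_pM2l.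
have DP : D <= C * P.
  apply: cancel => //; first exact: mulr_ge0.
  apply: le_trans DPN _; rewrite [leRHS](_ : _ = P * (C * D)); last by ring.
  exact: ler_wpM2l.
have PQ : P <= C ^+ 2 * Q.
  apply: cancel => //; first by rewrite mulr_ge0 ?exprn_ge0.
  apply: le_trans PNQ _; rewrite [leRHS](_ : _ = C * (C * P) * Q); last by ring.
  apply: ler_wpM2r => //; apply: le_trans ND _; exact: ler_wpM2l.
apply: le_trans DP _; rewrite [leRHS](_ : _ = C * (C ^+ 2 * Q)); last by ring.
exact: ler_wpM2l.
Qed.

Section a_priori.
Context (R : realType).
Local Notation leb := (@lebesgue_measure R).
Local Notation mu := (lebesgue_rV R).

(** Each line in the first direction has a point just outside the box where [f] vanishes;
    [section2_holder] from that point bounds f^2 pointwise on the line. *)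
Lemma poincare n L : exists2 C, 0 <= C & forall f, C1_on (box n.+1 L) f ->
  \int[mu n.+1]_x f x ^+ 2 <= C * \int[mu n.+1]_x (partial ord0 f x ^+ 2).
Proof.
have [mL Loo] := (measurable_seg L, seg_lty L).
(* The first factor bounds the distance from the base point -(|L| + 1) to the segment, the second
   comes from integrating in [t]. *)
pose K : R := (`|L| + `|L| + 1) * fine (leb (seg L)).
have K0 : 0 <= K by rewrite mulr_ge0 ?addr_ge0// fine_ge0.
exists K => // f Cf.
have [mB Boo] := (@measurable_box R n L, box_lty n L).
have bf := C1_on_bounded Cf; have bf2 := bounded_on_sqr bf.
have bp2 := bounded_on_sqr (C1_on_partial_bounded ord0 Cf).
rewrite (box_fubini2 bf2) (box_fubini2 bp2) -(bounded_on_RintegralZ mB Boo); last first.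
  exact: (bounded_on_fubini2 bp2).
apply: (bounded_on_le_Rintegral mB Boo).
- exact: (bounded_on_fubini2 bf2).
- by apply: bounded_onZ; exact: (bounded_on_fubini2 bp2).
move=> y.
have G0 : 0 <= \int[leb]_t (partial ord0 f (cons_rV (t, y)) ^+ 2).
  by apply: Rintegral_ge0 => t _; exact: sqr_ge0.
apply: le_trans (ler_norm _) _; rewrite /K mulrAC.
apply: (bounded_on_le_norm_Rintegral mL Loo); first exact: (bounded_on_section2 bf2 y).
move=> t; rewrite ger0_norm ?sqr_ge0//.
have [_ _ f0] := bf.
have [tL|tL] := pselect (seg L t); last first.
  rewrite f0 ?expr0n ?mulr_ge0 ?addr_ge0//.
  by move=> /box_cons[/tL].
have := section2_holder y (- (`|L| + 1)) t Cf.
rewrite (f0 (cons_rV (- (`|L| + 1), y))); last first.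
  move=> /box_cons[+ _]; rewrite /seg/= in_itv/= => /andP[+ _].
  have := ler_norm L; lra.
rewrite subr0 => /le_trans; apply; apply: ler_wpM2r => //.
move: tL; rewrite /seg/= in_itv/= => /andP[t1 t2].
have := ler_norm L => LL; rewrite ger0_norm; lra.
Qed.

Section green.
Variables (n : nat) (L : R).
Let mB := @measurable_box R n L.
Let Boo := @box_lty R n L.
Implicit Types f g : 'rV[R]_n -> R.

Let smooth_on f := smooth f /\ forall x, ~ box n L x -> f x = 0.

Let smooth_onC1 f : smooth_on f -> C1_on (box n L) f.
Proof. by move=> [? ?]; exact: smooth_C1_on. Qed.

Let smooth_on_bounded f : smooth_on f -> bounded_on (box n L) f.
Proof. by move=> /smooth_onC1; exact: C1_on_bounded. Qed.

Let smooth_on_partial i f : smooth_on f -> smooth_on (partial i f).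
Proof.
move=> [sf f0]; split; first exact: smooth_partial.
by apply: partial_eq0_off => //; exact: closed_box.
Qed.

Let smooth_on_laplacian f : smooth_on f -> smooth_on (laplacian f).
Proof.
move=> [sf f0]; split; first exact: smooth_laplacian.
by apply: laplacian_eq0_off => //; exact: closed_box.
Qed.

(** Green's first identity; its right-hand side is symmetric, which yields the second one. *)
Let laplacian_mul f g : smooth_on f -> smooth_on g ->
  \int[mu n]_x (laplacian f x * g x) =
  - \sum_i \int[mu n]_x (partial i f x * partial i g x).
Proof.
move=> sf sg; under eq_Rintegral do rewrite /laplacian mulr_suml.
rewrite (bounded_on_Rintegral_sum mB Boo); last first.
  move=> i; apply: bounded_on_mul; last exact: smooth_on_bounded.
  by apply: smooth_on_bounded; do 2 apply: smooth_on_partial.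
rewrite -sumrN; apply: eq_bigr => i _; apply: (@Rintegral_by_parts _ _ L).
  exact/smooth_onC1/smooth_on_partial.
exact: smooth_onC1.
Qed.

Let laplacian_symm f g : smooth_on f -> smooth_on g ->
  \int[mu n]_x (laplacian f x * g x) = \int[mu n]_x (f x * laplacian g x).
Proof.
move=> sf sg.
have fgC : \sum_i \int[mu n]_x (partial i f x * partial i g x) =
    \sum_i \int[mu n]_x (partial i g x * partial i f x).
  by apply: eq_bigr => i _; apply: eq_Rintegral => x _; rewrite mulrC.
rewrite (laplacian_mul sf sg) fgC -(laplacian_mul sg sf).
by apply: eq_Rintegral => x _; rewrite mulrC.
Qed.

(* With N = int f^2, D = int |grad f|^2, P = int (lap f)^2, Q = int (bilap f)^2,
   integration by parts gives D^2 <= P N and P^2 <= N Q. *)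
Lemma gradient_le_bilaplacian C f : 0 <= C ->
  smooth f -> (forall x, ~ box n L x -> f x = 0) ->
  \int[mu n]_x f x ^+ 2 <= C * \sum_i \int[mu n]_x (partial i f x ^+ 2) ->
  \sum_i \int[mu n]_x (partial i f x ^+ 2) <= C ^+ 3 * \int[mu n]_x (bilaplacian f x ^+ 2).
Proof.
move=> C0 sf f0; have S0 : smooth_on f by [].
have S1 := smooth_on_laplacian S0; have S2 := smooth_on_laplacian S1.
set N := \int[mu n]_x f x ^+ 2; set D := \sum_i _; set Q := \int[mu n]_x _ => ND.
pose P := \int[mu n]_x (laplacian f x ^+ 2).
have D0 : 0 <= D.
  by apply: sumr_ge0 => i _; apply: Rintegral_ge0 => x _; exact: sqr_ge0.
have Q0 : 0 <= Q by apply: Rintegral_ge0 => x _; exact: sqr_ge0.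
have P0 : 0 <= P by apply: Rintegral_ge0 => x _; exact: sqr_ge0.
have DNP : D ^+ 2 <= P * N.
  have -> : D = - \int[mu n]_x (laplacian f x * f x).
    rewrite (laplacian_mul S0 S0) opprK; apply: eq_bigr => i _.
    by apply: eq_Rintegral => x _; rewrite expr2.
  by rewrite sqrrN; apply: (bounded_on_cauchy_schwarz mB Boo); exact: smooth_on_bounded.
have PNQ : P ^+ 2 <= N * Q.
  have -> : P = \int[mu n]_x (f x * bilaplacian f x).
    by rewrite -[RHS](laplacian_symm S0 S1); apply: eq_Rintegral => x _; rewrite expr2.
  by apply: (bounded_on_cauchy_schwarz mB Boo); exact: smooth_on_bounded.
exact: (interpolation_chain C0 D0 P0 Q0 ND DNP PNQ).
Qed.

End green.
End a_priori.

(** * Compactness *)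

(** The image ultrafilter has a cluster point in the compact segment and converges to it: [U]
    contains the preimage of a ball or that of its complement, and clustering excludes the
    complement. *)
Lemma ultra_bounded_cauchy (R : realType) (U : set_system nat) (x : nat -> R) K :
  UltraFilter U -> (forall k, `|x k| <= K) ->
  forall e, 0 < e -> exists2 A, U A & forall k l, A k -> A l -> `|x k - x l| < e.
Proof.
move=> UU xK e e0.
have xUK : U (x @^-1` `[- K, K]%classic).
  suff -> : x @^-1` `[- K, K]%classic = setT by exact: filterT.
  by rewrite -subTset => k _; rewrite /= in_itv/= -ler_norml; exact: xK.
have [l [_ xl]] := @segment_compact R (- K) K _ (fmap_proper_filter x _) xUK.
pose A := x @^-1` ball l (e / 2); exists A.
  have [//|UA] := in_ultra_setVsetC A UU.
  have := xl (~` ball l (e / 2)) (ball l (e / 2)) UA.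
  by move=> /(_ (nbhsx_ballx _ _ _))[|y []//]; rewrite divr_gt0.
move=> i j xi xj; rewrite [ltRHS]splitr.
have := ball_triangle (ball_sym xi) xj; by rewrite -splitr.
Qed.

(** * Test functions and their bi-Laplacians as elements of L^2(Omega) *)

Section test_functions_L2.
Context (R : realType) (n : nat) (Omega : set 'rV[R]_n) (oOmega : open Omega).
Variable L : R.
Hypothesis OmegaL : Omega `<=` box n L.
Local Notation mu := (lebesgue_rV R n).
Local Notation nu := (lebesgue_on oOmega).
Implicit Types phi f : 'rV[R]_n -> R.

Lemma lebesgue_on_box_lty : (nu (box n L) < +oo)%E.
Proof.
apply: le_lt_trans (box_lty n L); rewrite /lebesgue_on /= /mrestr.
apply: le_measure; rewrite ?inE.
- by apply: measurableI; [exact: measurable_box|exact: open_measurable_rV].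
- exact: measurable_box.
- exact: subIsetl.
Qed.

(** Links the two measures: elements of [L2] are integrated against Lebesgue measure restricted to
    [Omega], whereas the estimates on boxes use the full measure. *)
Lemma Rintegral_lebesgue_on f : (forall x, ~ Omega x -> f x = 0) ->
  \int[nu]_x f x = \int[mu]_x f x.
Proof.
move=> f0; have fE : f = f \_ Omega.
  apply/funext => x; rewrite patchE; case: ifPn => //.
  by rewrite notin_setE => /f0.
rewrite fE -!Rintegral_mkcond /Rintegral; congr fine.
apply: eq_measure_integral => A mA AO.
by rewrite /lebesgue_on /= /mrestr setIidl.
Qed.

Lemma test_function_off_box phi : test_function Omega phi ->
  forall x, ~ box n L x -> phi x = 0.
Proof.
move=> [_ _ sO] x xL; apply: supp_eq0 => /sO /OmegaL; exact: xL.
Qed.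

Lemma bilaplacian_eq0_off phi x : ~ supp phi x -> bilaplacian phi x = 0.
Proof.
move=> xs; have cs : closed (supp phi) by exact: closed_closure.
apply: (laplacian_eq0_off cs) xs.
by apply: (laplacian_eq0_off cs) => y; exact: supp_eq0.
Qed.

Lemma smooth_Lfun2 f : smooth f -> (forall x, ~ box n L x -> f x = 0) ->
  f \in Lfun nu 2%:E.
Proof.
move=> sf f0; apply: (bounded_on_Lfun2 (@measurable_box R n L) lebesgue_on_box_lty).
by apply: continuous_bounded_on => //; exact: smooth_continuous.
Qed.

Lemma test_function_Lfun2 phi : test_function Omega phi -> phi \in Lfun nu 2%:E.
Proof.
move=> tphi; have [sphi _ _] := tphi.
by apply: smooth_Lfun2 => //; exact: test_function_off_box.
Qed.

Lemma bilaplacian_Lfun2 phi : test_function Omega phi -> bilaplacian phi \in Lfun nu 2%:E.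
Proof.
move=> tphi; have [sphi _ sO] := tphi.
apply: smooth_Lfun2; first by do 2 apply: smooth_laplacian.
move=> x xL; apply: bilaplacian_eq0_off => /sO /OmegaL; exact: xL.
Qed.

Definition test_L2 phi (h : test_function Omega phi) : L2 oOmega :=
  Lfun_Sub (lee1n 2) (test_function_Lfun2 h).

Definition bilap_L2 phi (h : test_function Omega phi) : L2 oOmega :=
  Lfun_Sub (lee1n 2) (bilaplacian_Lfun2 h).

Lemma bilap_L2_norm phi (h : test_function Omega phi) :
  L2norm (bilap_L2 h) ^+ 2 = \int[mu]_x bilaplacian phi x ^+ 2.
Proof.
rewrite /L2norm L2norm_sqr -Rintegral_lebesgue_on; last first.
  have [_ _ sO] := h.
  by move=> x Ox; rewrite bilaplacian_eq0_off ?expr0n// => /sO.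
by apply: eq_Rintegral => x _; rewrite expr2.
Qed.

Lemma weak_bilaplacian_pairing (f g : L2 oOmega) phi (h : test_function Omega phi) :
  is_weak_bilaplacian f g -> L2inner f (bilap_L2 h) = L2inner g (test_L2 h).
Proof. by move=> /(_ _ h). Qed.

Lemma orth_bilap_BH (f : L2 oOmega) :
  (forall phi (h : test_function Omega phi), L2inner (bilap_L2 h) f = 0) -> BH oOmega f.
Proof.
move=> fV phi h; rewrite -[LHS]/(L2inner f (bilap_L2 h)) /L2inner ipC.
rewrite [LHS]fV (_ : (fun x => _) = cst 0); last first.
  by apply/funext => x; exact: mul0r.
by rewrite Rintegral_cst// mul0r.
Qed.

Lemma L2orth_BH_approx (f : L2 oOmega) e : L2orth (BH oOmega) f -> 0 < e ->
  exists phi (h : test_function Omega phi), L2norm (f - bilap_L2 h) < e.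
Proof.
move=> fBH e0.
pose V := [set v : L2 oOmega | exists phi (h : test_function Omega phi), v = bilap_L2 h].
have [|||v [phi [h ->]] vf] := @L2_double_orth_approx _ _ _ _ V f _ _ _ e e0; last first.
- by exists phi, h.
- move=> h hV; apply: fBH; apply: orth_bilap_BH => phi hphi.
  by apply: hV; exists phi, hphi.
- move=> a _ _ [phi [hphi ->]] [psi [hpsi ->]].
  exists (fun x => a * phi x + psi x), (test_function_lin a hphi hpsi).
  have [sphi _ _] := hphi; have [spsi _ _] := hpsi.
  by apply/LfuneqP => x; rewrite /= (bilaplacian_lin a sphi spsi).
- have s0 : supp (fun _ : 'rV[R]_n => 0 : R) = set0.
    rewrite /supp (_ : [set _ | _] = set0) ?closure0//.
    by apply/seteqP; split => x //=; rewrite eqxx.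
  have h0 : test_function Omega (fun _ => 0).
    split; [exact: smooth0|rewrite s0; exact: compact0|by rewrite s0].
  exists (fun _ => 0), h0; apply/LfuneqP => x.
  by rewrite [RHS]bilaplacian_eq0_off// s0.
Qed.

End test_functions_L2.

Lemma ler_sum_sqrB (R : realFieldType) (I : finType) (a b c : I -> R) K :
  (forall i, c i <= 2 * a i + 2 * b i) -> \sum_i a i <= K -> \sum_i b i <= K ->
  \sum_i c i <= 4 * K.
Proof.
move=> cab aK bK; apply: (@le_trans _ _ (\sum_i (2 * a i + 2 * b i))).
  by apply: ler_sum => i _; exact: cab.
rewrite big_split/= -!mulr_sumr; lra.
Qed.

(** * A Rellich-type theorem for functions with bounded bi-Laplacian *)

Section rellich.
Context (R : realType) (n : nat) (L : R).
Local Notation mu := (lebesgue_rV R n.+1).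
Local Notation B := (box n.+1 L).
Implicit Types f g : 'rV[R]_n.+1 -> R.
Let mB := @measurable_box R n.+1 L.
Let Boo := @box_lty R n.+1 L.

Lemma Rintegral_sqrB_le f g : bounded_on B f -> bounded_on B g ->
  \int[mu]_x (f x - g x) ^+ 2 <= 2 * \int[mu]_x f x ^+ 2 + 2 * \int[mu]_x g x ^+ 2.
Proof.
move=> bf bg; have bf2 := bounded_on_sqr bf; have bg2 := bounded_on_sqr bg.
rewrite -!(bounded_on_RintegralZ mB Boo)// -(bounded_on_RintegralD mB Boo);
  [|exact: bounded_onZ..].
apply: (bounded_on_le_Rintegral mB Boo).
- by apply: bounded_on_sqr; exact: bounded_onB.
- by apply: bounded_onD; exact: bounded_onZ.
- by move=> x; have := sqr_ge0 (f x + g x); nra.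
Qed.

(** Only a bound uniform in [f] matters, so a crude one avoids square roots: a^2 <= b implies |a| <=
    b + 1. *)
Lemma Rintegral_weight_le f (w : 'rV[R]_n.+1 -> R) C : bounded_on B f -> measurable_fun setT w ->
  (forall x, `|w x| <= C) ->
  `|\int[mu]_x (f x * w x)| <=
     (\int[mu]_x f x ^+ 2) * (\int[mu]_x (\1_B x * w x) ^+ 2) + 1.
Proof.
move=> bf mw wC.
have bw : bounded_on B (fun x => \1_B x * w x).
  by apply: bounded_onM => //; [exact: bounded_on_indic|exists C].
have -> : \int[mu]_x (f x * w x) = \int[mu]_x (f x * (\1_B x * w x)).
  apply: eq_Rintegral => x _; have [xB|xB] := pselect (B x).
    by rewrite indicE mem_set// mul1r.
  by have [_ _ f0] := bf; rewrite f0// !mul0r.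
have := bounded_on_cauchy_schwarz mB Boo bf bw.
set a := Rintegral _ _ _; set b := _ * _ => ab.
have b0 : 0 <= b by exact: le_trans (sqr_ge0 a) ab.
rewrite -(ler_pXn2r (ltn0Sn 1)) ?nnegrE ?addr_ge0// real_normK ?num_real//.
apply: le_trans ab _; nra.
Qed.

(** The bound on the bi-Laplacian passes to the gradient ([K1]) and to the functions (C K1).
    Friedrichs' inequality for phi_k - phi_l then leaves finitely many bounded real sequences, each
    Cauchy along [U]. *)
Lemma bilaplacian_ultra_cauchy (U : set_system nat) (phi : nat -> 'rV[R]_n.+1 -> R) K :
  UltraFilter U -> (forall k, smooth (phi k)) ->
  (forall k x, ~ B x -> phi k x = 0) ->
  (forall k, \int[mu]_x (bilaplacian (phi k) x ^+ 2) <= K) ->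
  forall e, 0 < e -> exists2 A, U A &
    forall k l, A k -> A l -> \int[mu]_x (phi k x - phi l x) ^+ 2 < e.
Proof.
move=> UU sphi phi0 phiK e e0.
have [C C0 CP] := poincare n L.
have Cphi k : C1_on B (phi k) by exact: (smooth_C1_on (sphi k) (phi0 k)).
have bp i k : bounded_on B (partial i (phi k)) by exact: C1_on_partial_bounded.
have I0 f : 0 <= \int[mu]_x f x ^+ 2 by apply: Rintegral_ge0 => x _; exact: sqr_ge0.
have NC k : \int[mu]_x phi k x ^+ 2 <= C * \sum_i \int[mu]_x (partial i (phi k) x ^+ 2).
  apply: le_trans (CP _ (Cphi k)) _; apply: ler_wpM2l => //.
  by rewrite big_ord_recl lerDl sumr_ge0.
pose K1 := C ^+ 3 * K.
have DK k : \sum_i \int[mu]_x (partial i (phi k) x ^+ 2) <= K1.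
  apply: le_trans (gradient_le_bilaplacian C0 (sphi k) (phi0 k) (NC k)) _.
  by apply: ler_wpM2l; rewrite ?exprn_ge0.
have K10 : 0 <= K1 by apply: le_trans (DK 0%N); exact: sumr_ge0.
have NK k : \int[mu]_x phi k x ^+ 2 <= C * K1.
  by apply: le_trans (NC k) _; apply: ler_wpM2l.
(* The squared gradient norm of a difference is at most 4 K1, so this parameter keeps the gradient
   term below e / 2. The other half is shared among the weights, at most e / (2 c) each; the 1 added
   in [c] covers an empty [J]. *)
have eps0 : 0 < e / (8 * (K1 + 1)) by rewrite divr_gt0// mulr_gt0// ltr_wpDl.
have [J [w [bw wf]]] := @friedrichs R n.+1 L _ eps0.
pose c : R := #|J|%:R + 1.
have c0 : 0 < c by rewrite ltr_wpDl.
have d0 : 0 < Num.sqrt (e / (2 * c)) by rewrite sqrtr_gt0 divr_gt0// mulr_gt0.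
have /choice[A AP] : forall j, exists A, U A /\ forall k l, A k -> A l ->
    `|\int[mu]_x (phi k x * w j x) - \int[mu]_x (phi l x * w j x)| < Num.sqrt (e / (2 * c)).
  move=> j; have [mw [Cj wC] _] := bw j.
  have [|A UA AP] := @ultra_bounded_cauchy R U (fun k => \int[mu]_x (phi k x * w j x))
      (C * K1 * (\int[mu]_x (\1_B x * w j x) ^+ 2) + 1) UU _ _ d0; last by exists A.
  move=> k; apply: le_trans (Rintegral_weight_le (C1_on_bounded (Cphi k)) mw wC) _.
  by rewrite lerD2r ler_wpM2r.
(* A finite intersection of members of [U] treats all weights at once. *)
exists (fun k => forall j, A j k).
  by apply: filter_forall => j; have [] := AP j.
move=> k l Ak Al.
have Ckl : C1_on B (fun x => phi k x - phi l x) by exact: C1_onB.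
apply: le_lt_trans (wf _ Ckl) _; rewrite [ltRHS]splitr.
have part i : \int[mu]_x (partial i (fun x => phi k x - phi l x) x ^+ 2) <=
    2 * \int[mu]_x (partial i (phi k) x ^+ 2) + 2 * \int[mu]_x (partial i (phi l) x ^+ 2).
  have -> : partial i (fun x => phi k x - phi l x) =
      fun x => partial i (phi k) x - partial i (phi l) x.
    by apply/funext => x; rewrite /partial deriveB//; exact: smooth_derivable.
  exact: Rintegral_sqrB_le.
apply: ler_ltD.
  apply: (@le_trans _ _ (\sum_(j : J) e / (2 * c))).
    apply: ler_sum => j _; have [_ /(_ k l (Ak j) (Al j))] := AP j.
    have [mw wM _] := bw j.
    rewrite -(bounded_on_RintegralB mB Boo); last 2 first.
    - by apply: bounded_onM => //; exact: C1_on_bounded.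
    - by apply: bounded_onM => //; exact: C1_on_bounded.
    under eq_Rintegral do rewrite -mulrBl.
    move=> /ltW le_d; have ec0 : 0 <= e / (2 * c).
      by rewrite divr_ge0 ?(ltW e0)// mulr_ge0 ?(ltW c0).
    rewrite -[leLHS]real_normK ?num_real// -[leRHS](sqr_sqrtr ec0).
    by rewrite lerXn2r ?nnegrE ?sqrtr_ge0.
  have -> : \sum_(j : J) e / (2 * c) = e / 2 * (#|J|%:R / c).
    have cN0 : c != 0 by rewrite gt_eqF.
    by rewrite sumr_const -(mulr_natr _ #|J|); field.
  by rewrite ler_piMr ?divr_ge0 ?(ltW e0)// ler_pdivrMr// mul1r /c lerDl.
apply: (@le_lt_trans _ _ (e / (8 * (K1 + 1)) * (4 * K1))).
  apply: ler_wpM2l; first exact: ltW.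
  exact: ler_sum_sqrB part (DK k) (DK l).
rewrite mulrAC ltr_pdivrMr ?mulr_gt0 ?ltr_wpDl//.
rewrite [ltRHS](_ : _ = e * (4 * K1) + e * 4); last by field.
by rewrite ltrDl mulr_gt0.
Qed.

End rellich.

(** * Compactness of the embedding *)

Section compactness.
Context (R : realType) (n : nat) (Omega : set 'rV[R]_n) (oOmega : open Omega).
Local Notation nu := (lebesgue_on oOmega).
Local Notation Om := (L2 oOmega).

Lemma le_L2norm_Hbilap_norm (f : Om) : L2norm f <= Hbilap_norm oOmega f.
Proof.
rewrite /Hbilap_norm -[leLHS]ger0_norm ?L2norm_ge0// -sqrtr_sqr.
by apply: ler_wsqrtr; rewrite lerDl sqr_ge0.
Qed.

Lemma le_weak_bilaplacian_norm (f : Om) :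
  L2norm (weak_bilaplacian f) <= Hbilap_norm oOmega f.
Proof.
rewrite /Hbilap_norm -[leLHS]ger0_norm ?L2norm_ge0// -sqrtr_sqr.
by apply: ler_wsqrtr; rewrite lerDr sqr_ge0.
Qed.

Lemma weak_bilaplacianP (f : Om) : Hbilap oOmega f ->
  is_weak_bilaplacian f (weak_bilaplacian f).
Proof.
move=> fH; exact: (@xgetPex _ (0 : Om) [set g | is_weak_bilaplacian f g] fH).
Qed.

Lemma L2_fast_subseq_cvg (u : nat -> Om) (s : nat -> nat) :
  (forall k, L2norm (u (s k.+1) - u (s k)) <= 4^-1 ^+ k) ->
  exists f : Om, L2norm (u (s k) - f) @[k --> \oo] --> (0 : R).
Proof.
move=> us; have [f fP] := L2_complete (u := u \o s) us; exists f.
apply: (@squeeze_cvgr _ _ _ _ (fun=> 0) (fun k => 2 * 4^-1 ^+ k)).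
- by apply: nearW => k; rewrite L2norm_ge0/=; exact: fP.
- exact: cvg_cst.
- rewrite -[X in _ --> X](mulr0 2); apply: cvgM; first exact: cvg_cst.
  by apply: cvg_expr; rewrite ger0_norm//; lra.
Qed.

End compactness.

Lemma bounded_set_box (R : realType) n (A : set 'rV[R]_n) :
  bounded_set A -> exists L, A `<=` box n L.
Proof.
move=> [M [_ AM]]; exists (M + 1) => x Ax i.
have MM : M < M + 1 by rewrite ltrDl.
have := AM (M + 1) MM x Ax => /=.
rewrite -ler_norml; apply: le_trans.
rewrite [leRHS]/Num.norm /= mx_normrE.
exact: (@le_bigmax _ _ _ _ (fun i => `|x i.1 i.2|) (0, i)).
Qed.

(** In dimension 0 the Laplacian is an empty sum, so every element is biharmonic and [f] is
    orthogonal to itself. *)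
Lemma L2orth_BH_dim0 (R : realType) (Omega : set 'rV[R]_0) (oOmega : open Omega)
    (f : L2 oOmega) :
  L2orth (BH oOmega) f -> L2norm f = 0.
Proof.
move=> fBH; have : BH oOmega f.
  move=> phi _; apply: eq_Rintegral => x _.
  by rewrite /bilaplacian /laplacian big_ord0 mulr0 mul0r.
by move=> /fBH; rewrite /L2inner -L2norm_sqr => /eqP; rewrite sqrf_eq0 => /eqP.
Qed.

(** Orthogonality to [BH] enters only through the approximating test functions. The pairing estimate
    also uses off-diagonal pairs: the weak bi-Laplacian of u_k is tested against phi_l. *)
Lemma compact_embedding_seq (R : realType) n (Omega : set 'rV[R]_n.+1) (oOmega : open Omega) L
  (u : nat -> L2 oOmega) M :
  Omega `<=` box n.+1 L ->
  (forall k, Hbilap oOmega (u k) /\ L2orth (BH oOmega) (u k)) ->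
  (forall k, Hbilap_norm oOmega (u k) <= M) ->
  exists2 s : nat -> nat, {homo s : i j / (i < j)%N} &
    forall k, L2norm (u (s k.+1) - u (s k)) <= 4^-1 ^+ k.
Proof.
move=> OL uX uM.
pose g k := weak_bilaplacian (u k).
have gP k : is_weak_bilaplacian (u k) (g k) by apply: weak_bilaplacianP; have [] := uX k.
have uM' k : L2norm (u k) <= M by exact: le_trans (le_L2norm_Hbilap_norm _) (uM k).
have gM k : L2norm (g k) <= M by exact: le_trans (le_weak_bilaplacian_norm _) (uM k).
have M0 : 0 <= M by apply: le_trans (uM' 0%N); exact: L2norm_ge0.
have /choice[phi phiP] : forall k, exists phi,
    exists h : test_function Omega phi, L2norm (u k - bilap_L2 oOmega OL h) < 4^-1 ^+ k.
  by move=> k; apply: L2orth_BH_approx; [have [] := uX k|rewrite exprn_gt0].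
have tphi k : test_function Omega (phi k) by have [] := phiP k.
pose p k := test_L2 oOmega OL (tphi k).
pose b k := bilap_L2 oOmega OL (tphi k).
have ub k : L2norm (u k - b k) < 4^-1 ^+ k.
  (* The proof [h] chosen with [phi k] may differ from [tphi k], but both L^2 elements have the same
     underlying function. *)
  have [h] := phiP k; rewrite (_ : bilap_L2 oOmega OL h = b k)//.
  by apply/LfuneqP => x.
have bM k : L2norm (b k) <= M + 1.
  have : L2norm (b k) <= L2norm (u k) + L2norm (b k - u k).
    by apply: le_trans (L2norm_triangle _ _); rewrite addrC subrK.
  rewrite (_ : L2norm (b k - u k) = L2norm (u k - b k)); last exact: L2norm_distC.
  have := ub k; have := uM' k.
  have : 4^-1 ^+ k <= 1 :> R by rewrite exprn_ile1//; lra.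
  lra.
have [U [UU oU]] : exists U, UltraFilter U /\ \oo `<=` U by exact: ultraFilterLemma.
apply: (ultra_fast_subseq (D := fun k l => L2norm (u k - u l)) UU oU) => e e0.
(* Once |p_k - p_l| and both |u - b| are below [d], the pairing estimate gives at most 2 M d + 2 M
   (d + d) = 6 M d, which is less than K d = e^2. *)
pose K := 6 * M + 1.
have K0 : 0 < K by rewrite /K; lra.
pose d := e ^+ 2 / K.
have d0 : 0 < d by rewrite divr_gt0// exprn_gt0.
have bK k : \int[lebesgue_rV R n.+1]_x (bilaplacian (phi k) x ^+ 2) <= (M + 1) ^+ 2.
  rewrite -(bilap_L2_norm oOmega OL (tphi k)).
  by rewrite lerXn2r ?nnegrE ?L2norm_ge0 ?addr_ge0//; exact: bM.
have [A UA AP] := bilaplacian_ultra_cauchy UU (fun k => let: And3 s _ _ := tphi k in s)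
  (fun k => test_function_off_box OL (tphi k)) bK (exprn_gt0 2 d0).
have [N ke] := exists_expr4V_lt d0.
exists (A `&` [set k | (N <= k)%N]); first by apply: filterI => //; apply: oU; exists N.
move=> k l [Ak Nk] [Al Nl].
have pkl : L2norm (p k - p l) < d.
  rewrite -(ltr_pXn2r (ltn0Sn 1)) ?nnegrE ?L2norm_ge0 ?(ltW d0)//.
  rewrite [X in X < _](L2norm_sqr (p k - p l)).
  have := AP k l Ak Al; rewrite -(Rintegral_lebesgue_on oOmega); last first.
    move=> x Ox; have [_ _ sk] := tphi k; have [_ _ sl] := tphi l.
    rewrite (supp_eq0 (fun h => Ox (sk x h))) (supp_eq0 (fun h => Ox (sl x h))).
    by rewrite subrr expr0n.
  congr (_ < _); apply: eq_Rintegral => x _; by rewrite expr2.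
have ubN j : (N <= j)%N -> L2norm (u j - b j) < d.
  move=> Nj; apply: lt_trans (ub j) (le_lt_trans _ ke).
  by rewrite ler_wiXn2l//; lra.
have pair i j : L2inner (u i) (b j) = L2inner (g i) (p j) by exact: weak_bilaplacian_pairing.
rewrite -(ltr_pXn2r (ltn0Sn 1)) ?nnegrE ?L2norm_ge0 ?(ltW e0)//.
have h4 : L2norm (g k - g l) <= 2 * M.
  have := L2norm_triangle (g k) (- g l); rewrite (L2norm_opp (g l)).
  have := gM k; have := gM l; rewrite /L2norm; lra.
have h5 : L2norm (u k - u l) <= 2 * M.
  have := L2norm_triangle (u k) (- u l); rewrite (L2norm_opp (u l)).
  have := uM' k; have := uM' l; rewrite /L2norm; lra.
apply: le_lt_trans (L2norm_sqrB_le_pairing (pair k k) (pair k l) (pair l k) (pair l l)) _.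
apply: (@le_lt_trans _ _ (2 * M * d + 2 * M * (d + d))).
  apply: lerD; apply: ler_pM; rewrite ?addr_ge0 ?L2norm_ge0//; first exact: ltW.
  by apply: lerD; apply: ltW; [exact: (ubN k Nk)|exact: (ubN l Nl)].
have -> : e ^+ 2 = d * K by rewrite /d divfK// gt_eqF.
rewrite [ltRHS](_ : _ = 2 * M * d + 2 * M * (d + d) + d); last by rewrite /K; ring.
by rewrite ltrDl.
Qed.

Unset Implicit Arguments.

Theorem theorem2p16 (R : realType) (n : nat) (Omega : set 'rV[R]_n)
    (oOmega : open Omega) (cOmega : connected Omega)
    (Omega_neq0 : Omega !=set0) (bOmega : bounded_set Omega) :
  compact_embedding_L2
    (Hbilap oOmega `&` L2orth (BH oOmega))
    (Hbilap_norm oOmega).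
Proof.
split.
  by exists 1 => f _; rewrite mul1r; exact: le_L2norm_Hbilap_norm.
move=> u uX [M uM].
suff [s s_lt us] : exists2 s : nat -> nat, {homo s : i j / (i < j)%N} &
    forall k, L2norm (u (s k.+1) - u (s k)) <= 4^-1 ^+ k.
  by exists s => //; exact: L2_fast_subseq_cvg.
have [L OL] := bounded_set_box bOmega.
(* Dimension 0 is set apart because Poincare's inequality needs a coordinate direction; there every
   [u k] has norm 0, and the whole sequence serves as the subsequence. *)
case: n Omega oOmega {cOmega Omega_neq0 bOmega} L OL u uX uM =>
  [|n] Omega oOmega L OL u uX uM; last exact: compact_embedding_seq OL uX uM.
exists id => // k; have u0 j : L2norm (u j) = 0.
  by apply: L2orth_BH_dim0; have [] := uX j.
apply: le_trans (L2norm_triangle _ _) _.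
by rewrite (L2norm_opp (u k)) -!/(L2norm _) !u0 addr0 exprn_ge0.
Qed.
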